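(* Let $K|k$ be a finite Galois extension of fields with Galois group $G$, let $A$ be an abelian $k$-variety, let $W=\mathrm{Res}^K_k(A_K)$ be the Weil restriction of $A_K$ with respect to $K|k$, and let $t:G^{\mathrm{opp}}\to\mathrm{Aut}(\mathrm{End}(A_K))$ be the natural operation $\sigma\mapsto(\lambda\mapsto\sigma(\lambda)=\sigma\lambda\sigma^{-1})$. Then the map $$\mathrm{End}(A_K)^t[G^{\mathrm{opp}}]\longrightarrow \mathrm{End}(W),\qquad \sum_{\sigma\in G^{\mathrm{opp}}}\lambda_\sigma\,\sigma\;\mapsto\;\sum_{\sigma\in G^{\mathrm{opp}}}\mathrm{Res}^K_k(\lambda_\sigma)\,a_\sigma$$ from the skew group ring to the endomorphism ring of $W$ is an isomorphism of rings.
   Context: Homomorphisms and endomorphisms of abelian varieties over a field are always defined over that field; $A_K:=A\otimes_k K$. $G^{\mathrm{opp}}$ is identified with $\mathrm{Aut}_{\mathrm{Spec}(k)}(\mathrm{Spec}(K))$ (product = composition of scheme automorphisms). For a $k$-scheme $X$, $\sigma\in G^{\mathrm{opp}}$ also denotes the $k$-automorphism $\mathrm{id}_X\times\sigma$ of $X_K=X\times_k\mathrm{Spec}(K)$. For $k$-schemes $X,Z$ and a $K$-morphism $P:Z_K\to X_K$, put $\sigma(P):=\sigma P\sigma^{-1}$, again a $K$-morphism. Weil restriction: for an abelian $K$-variety $A'$, $\mathrm{Res}^K_k(A')$ is the abelian $k$-variety representing $Z\mapsto A'(Z\otimes_k K)$ from $k$-schemes to abelian groups, with universal element $u_{A'}:\mathrm{Res}^K_k(A')\otimes_kK\to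 A'$, a homomorphism of abelian $K$-varieties. For $\lambda\in\mathrm{End}(A')$, $\mathrm{Res}^K_k(\lambda)$ is the unique endomorphism with $u_{A'}\circ(\mathrm{Res}^K_k(\lambda)\otimes_k\mathrm{id}_K)=\lambda\circ u_{A'}$. Definition of $a_\tau$: for $\tau\in G^{\mathrm{opp}}$, $P\mapsto\tau(P)$ is an automorphism of the functor $Z\mapsto A_K(Z_K)$ from $k$-schemes to abelian groups, and $a_\tau\in\mathrm{Aut}(W)$ is the induced automorphism of the representing abelian variety $W$. The map $\tau\mapsto a_\tau$ is a group homomorphism $G^{\mathrm{opp}}\to\mathrm{Aut}(W)$. Skew group ring: for a ring $\Lambda$, a group $H$ and a group homomorphism $t:H\to\mathrm{Aut}(\Lambda)$ (write $\sigma(\lambda):=t(\sigma)(\lambda)$), with $H$ finite, $\Lambda^t[H]$ is the free left $\Lambda$-module on $H$ with multiplication $\sum_\sigma\lambda_\sigma\sigma\cdot\sum_\nu\mu_\nu\nu=\sum_{\sigma,\nu}\lambda_\sigma\,\sigma(\mu_\nu)\,\sigma\nu$. *)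

(* Defs.v *)
From HB Require Import structures.
From mathcomp Require Import all_boot all_order all_algebra all_fingroup.
From mathcomp Require Import all_solvable all_field.
From mathcomp Require Import ring_quotient generic_quotient.
From mathcomp Require Import boolp classical_sets topology_structure.
From mathcomp Require Import ring.

Set Implicit Arguments.
Unset Strict Implicit.
Unset Printing Implicit Defensive.
Import GRing.Theory.
Local Open Scope classical_set_scope.
Local Open Scope ring_scope.
Local Open Scope quotient_scope.

Section Invertible.
Variable R : comPzRingType.

Definition invertible (a : R) : Prop := exists b, a * b = 1.

Lemma invertible_mulI a x y : invertible a -> a * x = a * y -> x = y.
Proof.
by case=> b ab1 e; rewrite -[x]mul1r -[y]mul1r -ab1 ![_ * b]mulrC -!mulrA e.
Qed.

Lemma invertible1 : invertible 1.
Proof. by exists 1; rewrite mulr1. Qed.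

Lemma invertibleM a b : invertible a -> invertible b -> invertible (a * b).
Proof. by move=> [c ac] [d bd]; exists (c * d); rewrite mulrACA ac bd mulr1. Qed.

Lemma invertibleMl a b : invertible (a * b) -> invertible a.
Proof. by move=> [c abc]; exists (b * c); rewrite mulrA. Qed.

Lemma invertibleMr a b : invertible (a * b) -> invertible b.
Proof. by rewrite mulrC; apply: invertibleMl. Qed.

End Invertible.

Lemma rmorph_invertible (R S : comPzRingType) (f : {rmorphism R -> S}) a :
  invertible a -> invertible (f a).
Proof. by case=> b ab; exists (f b); rewrite -rmorphM ab rmorph1. Qed.

Lemma rmorph_eq (R S : pzSemiRingType) (f g : {rmorphism R -> S}) :
  f =1 g -> f = g.
Proof.
case: f g => f [[f1] [f2]] [g [[g1] [g2]]] /= /funext fg.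
rewrite {}fg in f1 f2 *.
by rewrite (Prop_irrelevance f1 g1) (Prop_irrelevance f2 g2).
Qed.

Record prime_ideal (R : comNzRingType) := PrimeIdeal {
  prime_pred : R -> bool;
  primeI : idealr_closed prime_pred;
  primeP : prime_idealr_closed prime_pred }.

HB.instance Definition _ (R : comNzRingType) : hasDecEq (prime_ideal R) :=
  gen_eqMixin (prime_ideal R).
HB.instance Definition _ (R : comNzRingType) : hasChoice (prime_ideal R) :=
  gen_choiceMixin (prime_ideal R).

Section PrimeIdeal.
Variable R : comNzRingType.
Implicit Types p q : prime_ideal R.

Lemma prime_ideal_eq p q : (forall a, (a \in prime_pred p) = (a \in prime_pred q)) -> p = q.
Proof.
case: p q => p p1 p2 [q q1 q2] /= pq.
have {}pq : p = q by apply/funext => a; have := pq a; rewrite -!topredE.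
by subst q; rewrite (Prop_irrelevance p1 q1) (Prop_irrelevance p2 q2).
Qed.

Lemma prime0 p : 0 \in prime_pred p.
Proof. by have [] := primeI p. Qed.

Lemma prime1 p : 1 \notin prime_pred p.
Proof. by have [] := primeI p. Qed.

Lemma primeD p a b : a \in prime_pred p -> b \in prime_pred p -> a + b \in prime_pred p.
Proof. by have [_ _ h] := primeI p => pa pb; have := h 1 a b pa pb; rewrite mul1r. Qed.

Lemma primeMl p a b : b \in prime_pred p -> a * b \in prime_pred p.
Proof.
have [p0 _ h] := primeI p => pb.
by have := h a b 0 pb p0; rewrite addr0.
Qed.

Lemma primeM p a b : (a * b \in prime_pred p) = (a \in prime_pred p) || (b \in prime_pred p).
Proof.
apply/idP/orP; first by move/primeP/orP.
by case=> h; [rewrite mulrC|]; apply: primeMl.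
Qed.

Lemma prime_notM p a b :
  a \notin prime_pred p -> b \notin prime_pred p -> a * b \notin prime_pred p.
Proof. by rewrite primeM negb_or => -> ->. Qed.

(* The Zariski topology: the D(f) = [set p | f \notin p] form a basis. *)
Definition zariski_open : set_system (prime_ideal R) :=
  [set U | forall p, U p ->
     exists f, f \notin prime_pred p /\ [set q : prime_ideal R | f \notin prime_pred q] `<=` U].

Lemma zariski_openT : zariski_open setT.
Proof. by move=> p _; exists 1; split=> //; apply: prime1. Qed.

Lemma zariski_openI : setI_closed zariski_open.
Proof.
move=> U V oU oV p [/oU[f [pf fU]] /oV[g [pg gV]]].
exists (f * g); split; first exact: prime_notM.
move=> q /=; rewrite primeM negb_or => /andP[qf qg].
by split; [apply: fU | apply: gV].
Qed.

Lemma zariski_open_bigU (I : Type) (U : I -> set (prime_ideal R)) :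
  (forall i, zariski_open (U i)) -> zariski_open (\bigcup_i U i).
Proof.
move=> oU p [i _ /oU[f [pf fU]]]; exists f; split=> // q qf.
by exists i => //; apply: fU.
Qed.

HB.instance Definition _ :=
  isOpenTopological.Build (prime_ideal R) zariski_openT zariski_openI zariski_open_bigU.

Lemma zariskiE : open = zariski_open.
Proof. reflexivity. Qed.

Lemma zariski_basic f : open [set q : prime_ideal R | f \notin prime_pred q].
Proof. by rewrite zariskiE => p pf; exists f; split. Qed.

End PrimeIdeal.

Section Localization.
Variables (R : comNzRingType) (p : prime_ideal R).

Definition denom := {s : R | s \notin prime_pred p}.

Definition mk_denom (s : R) (ps : s \notin prime_pred p) : denom :=
  exist (fun s => s \notin prime_pred p) s ps.
Lemma denomP (s : denom) : sval s \notin prime_pred p.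
Proof. exact: (proj2_sig s). Qed.
Definition denomM (s t : denom) : denom := mk_denom (prime_notM (denomP s) (denomP t)).
Definition denom1 : denom := mk_denom (prime1 p).

Definition loc_rel (x y : R * denom) : bool :=
  `[< exists u : denom, sval u * (x.1 * sval y.2 - y.1 * sval x.2) = 0 >].

Lemma loc_rel_refl : reflexive loc_rel.
Proof. by move=> x; apply/asboolP; exists denom1; rewrite subrr mulr0. Qed.

Lemma loc_rel_sym : symmetric loc_rel.
Proof.
move=> x y; apply/asboolP/asboolP => -[u e]; exists u.
  by rewrite -opprB mulrN e oppr0.
by rewrite -opprB mulrN e oppr0.
Qed.

Lemma loc_rel_trans : transitive loc_rel.
Proof.
move=> y x z /asboolP[u e] /asboolP[v e']; apply/asboolP.
exists (denomM (denomM u v) y.2) => /=.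
transitivity (sval v * sval z.2 * (sval u * (x.1 * sval y.2 - y.1 * sval x.2))
  + sval u * sval x.2 * (sval v * (y.1 * sval z.2 - z.1 * sval y.2))); first by ring.
by rewrite e e' !mulr0 addr0.
Qed.

Canonical loc_equiv := EquivRel loc_rel loc_rel_refl loc_rel_sym loc_rel_trans.

Definition localization := {eq_quot loc_rel}.
HB.instance Definition _ : EqQuotient _ loc_rel localization := EqQuotient.on localization.
HB.instance Definition _ := Choice.on localization.

Definition loc_frac (a : R) (s : denom) : localization := \pi_localization (a, s).

Lemma loc_fracP a s b t :
  loc_frac a s = loc_frac b t <-> exists u : denom, sval u * (a * sval t - b * sval s) = 0.
Proof.
split=> [/eqmodP/asboolP//|h]; exact/eqmodP/asboolP.
Qed.

Lemma loc_ind (P : localization -> Prop) : (forall a s, P (loc_frac a s)) -> forall x, P x.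
Proof. by move=> h; elim/quotW => -[a s]; apply: h. Qed.

Definition loc_num (x : localization) : R := (repr x).1.
Definition loc_den (x : localization) : denom := (repr x).2.

Lemma loc_reprK x : loc_frac (loc_num x) (loc_den x) = x.
Proof. by rewrite /loc_frac -surjective_pairing reprK. Qed.

Definition loc_add x y := loc_frac
  (loc_num x * sval (loc_den y) + loc_num y * sval (loc_den x)) (denomM (loc_den x) (loc_den y)).
Definition loc_opp x := loc_frac (- loc_num x) (loc_den x).
Definition loc_mul x y := loc_frac (loc_num x * loc_num y) (denomM (loc_den x) (loc_den y)).

Lemma loc_addE a s b t :
  loc_add (loc_frac a s) (loc_frac b t) = loc_frac (a * sval t + b * sval s) (denomM s t).
Proof.
have /loc_fracP[u e] := loc_reprK (loc_frac a s).
have /loc_fracP[v e'] := loc_reprK (loc_frac b t).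
rewrite /loc_add; apply/loc_fracP; exists (denomM u v) => /=.
set a' := loc_num _ in e *; set s' := loc_den _ in e *.
set b' := loc_num _ in e' *; set t' := loc_den _ in e' *.
transitivity (sval v * sval t * sval t' * (sval u * (a' * sval s - a * sval s'))
  + sval u * sval s * sval s' * (sval v * (b' * sval t - b * sval t'))); first by ring.
by rewrite e e' !mulr0 addr0.
Qed.

Lemma loc_oppE a s : loc_opp (loc_frac a s) = loc_frac (- a) s.
Proof.
have /loc_fracP[u e] := loc_reprK (loc_frac a s).
rewrite /loc_opp; apply/loc_fracP; exists u.
by rewrite !mulNr -opprD mulrN e oppr0.
Qed.

Lemma loc_mulE a s b t :
  loc_mul (loc_frac a s) (loc_frac b t) = loc_frac (a * b) (denomM s t).
Proof.
have /loc_fracP[u e] := loc_reprK (loc_frac a s).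
have /loc_fracP[v e'] := loc_reprK (loc_frac b t).
rewrite /loc_mul; apply/loc_fracP; exists (denomM u v) => /=.
set a' := loc_num _ in e *; set s' := loc_den _ in e *.
set b' := loc_num _ in e' *; set t' := loc_den _ in e' *.
transitivity (sval v * b' * sval t * (sval u * (a' * sval s - a * sval s'))
  + sval u * a * sval s' * (sval v * (b' * sval t - b * sval t'))); first by ring.
by rewrite e e' !mulr0 addr0.
Qed.

Lemma loc_frac_eq a s b t : a * sval t = b * sval s -> loc_frac a s = loc_frac b t.
Proof. by move=> e; apply/loc_fracP; exists denom1; rewrite e subrr mulr0. Qed.

Lemma loc_addA : associative loc_add.
Proof.
elim/loc_ind=> a s; elim/loc_ind=> b t; elim/loc_ind=> c u.
by rewrite !loc_addE; apply: loc_frac_eq => /=; ring.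
Qed.

Lemma loc_addC : commutative loc_add.
Proof.
elim/loc_ind=> a s; elim/loc_ind=> b t.
by rewrite !loc_addE; apply: loc_frac_eq => /=; ring.
Qed.

Lemma loc_add0 : left_id (loc_frac 0 denom1) loc_add.
Proof. by elim/loc_ind=> a s; rewrite loc_addE; apply: loc_frac_eq => /=; ring. Qed.

Lemma loc_addN : left_inverse (loc_frac 0 denom1) loc_opp loc_add.
Proof.
by elim/loc_ind=> a s; rewrite loc_oppE loc_addE; apply: loc_frac_eq => /=; ring.
Qed.

HB.instance Definition _ :=
  GRing.isZmodule.Build localization loc_addA loc_addC loc_add0 loc_addN.

Lemma loc_mulA : associative loc_mul.
Proof.
elim/loc_ind=> a s; elim/loc_ind=> b t; elim/loc_ind=> c u.
by rewrite !loc_mulE; apply: loc_frac_eq => /=; ring.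
Qed.

Lemma loc_mulC : commutative loc_mul.
Proof.
elim/loc_ind=> a s; elim/loc_ind=> b t.
by rewrite !loc_mulE; apply: loc_frac_eq => /=; ring.
Qed.

Lemma loc_mul1 : left_id (loc_frac 1 denom1) loc_mul.
Proof. by elim/loc_ind=> a s; rewrite loc_mulE; apply: loc_frac_eq => /=; ring. Qed.

Lemma loc_mulDl : left_distributive loc_mul loc_add.
Proof.
elim/loc_ind=> a s; elim/loc_ind=> b t; elim/loc_ind=> c u.
by rewrite !(loc_mulE, loc_addE); apply: loc_frac_eq => /=; ring.
Qed.

Lemma loc_1neq0 : loc_frac 1 denom1 != loc_frac 0 denom1.
Proof.
apply/eqP => /loc_fracP[u]; rewrite mulr1 mul0r subr0 mulr1 => u0.
by have := denomP u; rewrite u0 prime0.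
Qed.

HB.instance Definition _ := GRing.Zmodule_isComNzRing.Build localization
  loc_mulA loc_mulC loc_mul1 loc_mulDl loc_1neq0.

Definition to_loc (a : R) : localization := loc_frac a denom1.

Lemma to_loc_zmod : zmod_morphism to_loc.
Proof.
move=> a b; rewrite -[RHS]/(loc_add _ (loc_opp _)) loc_oppE loc_addE.
by apply: loc_frac_eq => /=; ring.
Qed.

Lemma to_loc_monoid : monoid_morphism to_loc.
Proof.
split=> // a b; rewrite -[RHS]/(loc_mul _ _) loc_mulE.
by apply: loc_frac_eq => /=; ring.
Qed.

HB.instance Definition _ := GRing.isZmodMorphism.Build R localization to_loc to_loc_zmod.
HB.instance Definition _ := GRing.isMonoidMorphism.Build R localization to_loc to_loc_monoid.

Lemma to_loc_frac a (s : denom) : to_loc (sval s) * loc_frac a s = to_loc a.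
Proof.
rewrite -[LHS]/(loc_mul _ _) loc_mulE; apply: loc_frac_eq => /=; ring.
Qed.

Lemma loc_exists (x : localization) :
  exists a s, s \notin prime_pred p /\ to_loc s * x = to_loc a.
Proof.
elim/loc_ind: x => a s; exists a, (sval s); split; [exact: denomP|exact: to_loc_frac].
Qed.

Lemma to_loc_eq0 a : to_loc a = 0 <-> exists2 s, s \notin prime_pred p & s * a = 0.
Proof.
split=> [/loc_fracP[u]|[s ps sa]].
  by rewrite mulr1 mul0r subr0 => e; exists (sval u); first exact: denomP.
by apply/loc_fracP; exists (mk_denom ps); rewrite mulr1 mul0r subr0.
Qed.

Lemma to_loc_unit a : invertible (to_loc a) <-> a \notin prime_pred p.
Proof.
split=> [[x ax]|pa]; last first.
  exists (loc_frac 1 (mk_denom pa)).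
  exact: etrans (to_loc_frac 1 (mk_denom pa)) (rmorph1 to_loc).
have [b [s [ps sx]]] := loc_exists x.
have : to_loc (s - a * b) = 0.
  by rewrite rmorphB rmorphM /= -sx mulrCA ax mulr1 subrr.
case/to_loc_eq0 => t pt e; apply/negP => pa.
have : t * s \in prime_pred p.
  have -> : t * s = t * b * a + t * (s - a * b) by ring.
  by rewrite e addr0; apply: primeMl.
by rewrite primeM (negbTE ps) (negbTE pt).
Qed.

Lemma loc_unit a s (x : localization) : s \notin prime_pred p -> to_loc s * x = to_loc a ->
  invertible x <-> a \notin prime_pred p.
Proof.
move=> ps e; rewrite -to_loc_unit -e; split=> [ux|]; last exact: invertibleMr.
by apply: invertibleM => //; apply/to_loc_unit.
Qed.

Lemma loc_local (x y : localization) : invertible (x + y) -> invertible x \/ invertible y.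
Proof.
have [a [s [ps ea]]] := loc_exists x; have [b [t [pt eb]]] := loc_exists y.
rewrite (loc_unit ps ea) (loc_unit pt eb) (@loc_unit (a * t + b * s) (s * t)).
- move=> h; apply: contrapT => /not_orP[/negP/negPn pa /negP/negPn pb].
  by move: h; rewrite primeD // mulrC primeMl.
- exact: prime_notM.
- by rewrite rmorphD !rmorphM /= -ea -eb; ring.
Qed.

Lemma loc_rmorph_eq (B : comNzRingType) (f g : {rmorphism localization -> B}) :
  (forall a, f (to_loc a) = g (to_loc a)) -> f = g.
Proof.
move=> fg; apply: rmorph_eq => x; have [a [s [ps e]]] := loc_exists x.
apply: (@invertible_mulI _ (f (to_loc s))).
  by apply: rmorph_invertible; apply/to_loc_unit.
by rewrite -rmorphM e !fg -rmorphM e.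
Qed.

End Localization.

Arguments to_loc {R} p a.

Section LocalizationMap.
Variables (R S : comNzRingType) (f : {rmorphism R -> S}) (q : prime_ideal S).

Lemma preim_primeI : idealr_closed [pred a | f a \in prime_pred q].
Proof.
split; rewrite ?inE /= ?rmorph0 ?rmorph1 ?prime0 ?prime1 // => a u v.
by rewrite !inE => qu qv; rewrite rmorphD rmorphM primeD ?primeMl.
Qed.

Lemma preim_primeP : prime_idealr_closed [pred a | f a \in prime_pred q].
Proof. by move=> u v; rewrite !inE rmorphM primeM. Qed.

Definition preim_prime : prime_ideal R := PrimeIdeal preim_primeI preim_primeP.

Lemma mem_preim_prime a : (a \in prime_pred preim_prime) = (f a \in prime_pred q).
Proof. by []. Qed.

Lemma preim_denom (s : denom preim_prime) : f (sval s) \notin prime_pred q.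
Proof. exact: (denomP s). Qed.

Definition loc_map (x : localization preim_prime) : localization q :=
  loc_frac (f (loc_num x)) (mk_denom (preim_denom (loc_den x))).

Lemma loc_mapP a s x : s \notin prime_pred preim_prime ->
  to_loc _ s * x = to_loc _ a -> to_loc q (f s) * loc_map x = to_loc q (f a).
Proof.
move=> ps; rewrite /loc_map; set s' := mk_denom _.
rewrite -{1}[x]loc_reprK => e; apply: (@invertible_mulI _ (to_loc q (sval s'))).
  by apply/to_loc_unit; apply: denomP.
rewrite mulrCA to_loc_frac -!rmorphM.
have : to_loc preim_prime (s * loc_num x - sval (loc_den x) * a) = 0.
  rewrite rmorphB !rmorphM /= -(to_loc_frac (loc_num x) (loc_den x)) mulrCA e.
  by rewrite subrr.
case/to_loc_eq0 => t qt e0; apply/subr0_eq; rewrite -rmorphB; apply/to_loc_eq0.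
exists (f t) => //.
by rewrite -!(rmorphM, rmorphB) e0 rmorph0.
Qed.

Lemma loc_map_to_loc a : loc_map (to_loc _ a) = to_loc q (f a).
Proof.
have := @loc_mapP a 1 (to_loc _ a) (prime1 _).
by rewrite !rmorph1 !mul1r; apply.
Qed.

Lemma loc_mapU s x y : s \notin prime_pred preim_prime ->
  to_loc q (f s) * x = to_loc q (f s) * y -> x = y.
Proof. by move=> ps; apply: invertible_mulI; apply/to_loc_unit. Qed.

Lemma loc_map_zmod : zmod_morphism loc_map.
Proof.
move=> x y; have [a [s [ps ea]]] := loc_exists x.
have [b [t [pt eb]]] := loc_exists y.
have e : to_loc _ (s * t) * (x - y) = to_loc _ (a * t - b * s).
  by rewrite rmorphB !rmorphM /= -ea -eb; ring.
apply: (loc_mapU (prime_notM ps pt)); rewrite (loc_mapP (prime_notM ps pt) e).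
rewrite mulrBr !rmorphM !rmorphB !rmorphM /= -(loc_mapP ps ea) -(loc_mapP pt eb).
by ring.
Qed.

Lemma loc_map_monoid : monoid_morphism loc_map.
Proof.
split; first by rewrite -[1](rmorph1 (to_loc preim_prime)) loc_map_to_loc !rmorph1.
move=> x y; have [a [s [ps ea]]] := loc_exists x.
have [b [t [pt eb]]] := loc_exists y.
have e : to_loc _ (s * t) * (x * y) = to_loc _ (a * b).
  by rewrite !rmorphM /= -ea -eb; ring.
apply: (loc_mapU (prime_notM ps pt)); rewrite (loc_mapP (prime_notM ps pt) e).
by rewrite !rmorphM /= -(loc_mapP ps ea) -(loc_mapP pt eb); ring.
Qed.

HB.instance Definition _ := GRing.isZmodMorphism.Build _ _ loc_map loc_map_zmod.
HB.instance Definition _ := GRing.isMonoidMorphism.Build _ _ loc_map loc_map_monoid.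

Lemma loc_map_unit x : invertible (loc_map x) -> invertible x.
Proof.
have [a [s [ps e]]] := loc_exists x.
rewrite (loc_unit ps e) mem_preim_prime.
by rewrite -(@loc_unit _ q (f a) (f s) (loc_map x)) //; apply: loc_mapP.
Qed.

End LocalizationMap.

(* The structure sheaf is presented by its stalks: a section over [U] is the
   family of its germs, i.e. a function [s : forall x, stalk x], of which only
   the values on [U] matter.  [germ_surj] and [germ_inj] say that [stalk x] is
   the colimit of the sections over the open neighbourhoods of [x]; [sec_sheaf]
   says that being a section is a local property, and contains the restriction
   maps, locality and gluing. *)
Record lrs := Lrs {
  lrs_point :> topologicalType;
  stalk : lrs_point -> comNzRingType;
  sec : set lrs_point -> set (forall x, stalk x);
  sec_sheaf : forall U s, open U ->
    (forall x, U x -> exists V t,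
       [/\ open V, V x, sec V t & forall y, U y -> V y -> s y = t y]) ->
    sec U s;
  sec1 : forall U, open U -> sec U (fun=> 1);
  secB : forall U s t, open U -> sec U s -> sec U t -> sec U (fun x => s x - t x);
  secM : forall U s t, open U -> sec U s -> sec U t -> sec U (fun x => s x * t x);
  germ_surj : forall x (a : stalk x), exists U s, [/\ open U, U x, sec U s & s x = a];
  germ_inj : forall U s x, open U -> sec U s -> U x -> s x = 0 ->
    exists V, [/\ open V, V x, V `<=` U & forall y, V y -> s y = 0];
  stalk_local : forall x (a b : stalk x),
    invertible (a + b) -> invertible a \/ invertible b }.

Arguments stalk {l} x.
Arguments sec {l} U s.

(* A morphism sends [x] to a point [f x] together with a ring homomorphism
   from the stalk at [f x] to the stalk at [x]; packing both in a sigma type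
   makes Leibniz equality of morphisms the right notion of equality. *)
Record hom (X Y : lrs) := Hom {
  hom_germ : forall x : X, {y : Y & {rmorphism stalk y -> stalk x}};
  hom_continuous : continuous (fun x => tag (hom_germ x));
  hom_local : forall x a, invertible (tagged (hom_germ x) a) -> invertible a;
  hom_sec : forall V s, open V -> sec V s ->
    sec ((fun x => tag (hom_germ x)) @^-1` V)
        (fun x => tagged (hom_germ x) (s (tag (hom_germ x)))) }.

Definition hom_fun X Y (f : hom X Y) (x : X) : Y := tag (hom_germ f x).
Coercion hom_fun : hom >-> Funclass.

Definition stalk_map X Y (f : hom X Y) (x : X) :
  {rmorphism stalk (f x) -> stalk x} := tagged (hom_germ f x).

Lemma hom_eq X Y (f g : hom X Y) :
  (forall x, hom_germ f x = hom_germ g x) -> f = g.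
Proof.
case: f g => f f1 f2 f3 [g g1 g2 g3] /= fg.
have e : f = g by apply: functional_extensionality_dep.
subst g.
by rewrite (Prop_irrelevance f1 g1) (Prop_irrelevance f2 g2) (Prop_irrelevance f3 g3).
Qed.

Section Category.
Variables X Y Z : lrs.

Program Definition hom_id : hom X X :=
  @Hom X X (fun x => Tagged (fun y => {rmorphism stalk y -> stalk x})
    [the {rmorphism _ -> _} of idfun]) _ _ _.
Next Obligation. by move=> x; apply: cvg_id. Qed.
Next Obligation. by []. Qed.
Next Obligation. by []. Qed.

Program Definition hom_comp (g : hom Y Z) (f : hom X Y) : hom X Z :=
  @Hom X Z (fun x => Tagged (fun z => {rmorphism stalk z -> stalk x})
    [the {rmorphism _ -> _} of stalk_map f x \o stalk_map g (f x)]) _ _ _.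
Next Obligation.
move=> g f x; apply: continuous_comp; first exact: hom_continuous.
exact: hom_continuous.
Qed.
Next Obligation. by move=> g f x a /hom_local/hom_local. Qed.
Next Obligation.
move=> g f V s oV sV.
have oU : open (hom_fun g @^-1` V).
  by apply: open_comp => // y _; apply: hom_continuous.
have := @hom_sec _ _ f _ _ oU (@hom_sec _ _ g _ _ oV sV).
by [].
Qed.

End Category.

Arguments hom_id {X}.

Reserved Notation "g \oS f" (at level 50, left associativity, format "g  \oS  f").
Notation "g \oS f" := (hom_comp g f).

Lemma hom_compA X Y Z T (h : hom Z T) (g : hom Y Z) (f : hom X Y) :
  h \oS (g \oS f) = h \oS g \oS f.
Proof. by apply: hom_eq => x; congr existT; apply: rmorph_eq. Qed.

Lemma hom_comp1l X Y (f : hom X Y) : hom_id \oS f = f.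
Proof.
apply: hom_eq => x; rewrite /= /stalk_map /hom_fun /=.
by case: (hom_germ f x) => y h; congr existT; apply: rmorph_eq.
Qed.

Lemma hom_comp1r X Y (f : hom X Y) : f \oS hom_id = f.
Proof.
apply: hom_eq => x; rewrite /= /stalk_map /hom_fun /=.
by case: (hom_germ f x) => y h; congr existT; apply: rmorph_eq.
Qed.

Section Spec.
Variable R : comNzRingType.

(* [s q] is the fraction [a / f] for all [q] in a neighbourhood of [p]. *)
Definition spec_sec (U : set (prime_ideal R)) :
    set (forall p : prime_ideal R, localization p) :=
  [set s | forall p, U p -> exists V a f, [/\ open V, V p, V `<=` U &
     forall q, V q -> f \notin prime_pred q /\ to_loc q f * s q = to_loc q a]].

Lemma spec_sheaf U s : open U ->
  (forall x, U x -> exists V t,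
     [/\ open V, V x, spec_sec V t & forall y, U y -> V y -> s y = t y]) ->
  spec_sec U s.
Proof.
move=> oU h p Up; have [V [t [oV Vp sV e]]] := h p Up.
have [W [a [f [oW Wp WV et]]]] := sV p Vp.
exists (W `&` U), a, f; split=> //; first exact: openI.
by move=> q [Wq Uq]; rewrite e //; [apply: et | apply: WV].
Qed.

Lemma spec_sec1 U : open U -> spec_sec U (fun=> 1).
Proof.
move=> oU p Up; exists U, 1, 1; split=> // q _.
by rewrite prime1 mulr1.
Qed.

Lemma spec_secB U s t : open U ->
  spec_sec U s -> spec_sec U t -> spec_sec U (fun x => s x - t x).
Proof.
move=> oU hs ht p Up; have [V [a [f [oV Vp VU e]]]] := hs p Up.
have [W [b [g [oW Wp WU e']]]] := ht p Up.
exists (V `&` W), (a * g - b * f), (f * g); split=> //; first exact: openI.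
  by move=> q [/VU].
move=> q [/e[qf ef] /e'[qg eg]]; split; first exact: prime_notM.
by rewrite rmorphB !rmorphM /= -ef -eg; ring.
Qed.

Lemma spec_secM U s t : open U ->
  spec_sec U s -> spec_sec U t -> spec_sec U (fun x => s x * t x).
Proof.
move=> oU hs ht p Up; have [V [a [f [oV Vp VU e]]]] := hs p Up.
have [W [b [g [oW Wp WU e']]]] := ht p Up.
exists (V `&` W), (a * b), (f * g); split=> //; first exact: openI.
  by move=> q [/VU].
move=> q [/e[qf ef] /e'[qg eg]]; split; first exact: prime_notM.
by rewrite !rmorphM /= -ef -eg; ring.
Qed.

Lemma spec_germ_surj (p : prime_ideal R) (x : localization p) :
  exists U s, [/\ open U, U p, spec_sec U s & s p = x].
Proof.
have [a [f [pf e]]] := loc_exists x.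
have h (q : prime_ideal R) : exists y : localization q,
    f \notin prime_pred q -> to_loc q f * y = to_loc q a.
  case: (boolP (f \in prime_pred q)) => qf; first by exists 0.
  exists (loc_frac a (mk_denom qf)) => _.
  exact: (to_loc_frac a (mk_denom qf)).
pose s q := sval (cid (h q)).
have sP q : f \notin prime_pred q -> to_loc q f * s q = to_loc q a.
  by rewrite /s; case: cid.
exists [set q | f \notin prime_pred q], s; split=> //.
- exact: zariski_basic.
- move=> q qf; exists [set q | f \notin prime_pred q], a, f; split=> //.
    exact: zariski_basic.
  by move=> q' qf'; split=> //; apply: sP.
- apply: (@invertible_mulI _ (to_loc p f)); first exact/to_loc_unit.
  by rewrite e sP.
Qed.

Lemma spec_germ_inj U s (p : prime_ideal R) : open U -> spec_sec U s -> U p -> s p = 0 ->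
  exists V, [/\ open V, V p, V `<=` U & forall q, V q -> s q = 0].
Proof.
move=> oU hs Up sp0; have [V [a [f [oV Vp VU e]]]] := hs p Up.
have [_] := e p Vp; rewrite sp0 mulr0 => /esym/to_loc_eq0[u pu ua].
exists (V `&` [set q | u \notin prime_pred q]); split=> //.
- by apply: openI => //; apply: zariski_basic.
- by move=> q [/VU].
move=> q [Vq qu]; have [qf ef] := e q Vq.
apply: (@invertible_mulI _ (to_loc q f)); first exact/to_loc_unit.
by rewrite ef mulr0; apply/to_loc_eq0; exists u.
Qed.

Definition spec : lrs := @Lrs (prime_ideal R) (@localization R) spec_sec
  spec_sheaf spec_sec1 spec_secB spec_secM spec_germ_surj spec_germ_inj
  (@loc_local R).

End Spec.

Section SpecHom.
Variables (R S : comNzRingType) (f : {rmorphism R -> S}).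

Definition spec_germ (q : spec S) :
    {p : spec R & {rmorphism stalk p -> stalk q}} :=
  Tagged (fun p : spec R => {rmorphism stalk p -> stalk q})
    ([the {rmorphism _ -> _} of @loc_map R S f q] :
      {rmorphism stalk (preim_prime f q : spec R) -> stalk q}).

Lemma spec_continuous : continuous (fun q => tag (spec_germ q)).
Proof.
apply/continuousP => U oU; rewrite zariskiE => q /= Uq.
move: oU; rewrite zariskiE => /(_ _ Uq)[a [qa aU]].
by exists (f a); split=> // q' /= q'a; apply: aU.
Qed.

Lemma spec_hom_sec (V : set (spec R)) s : open V -> sec V s ->
  sec ((fun q => tag (spec_germ q)) @^-1` V)
      (fun q => tagged (spec_germ q) (s (tag (spec_germ q)))).
Proof.
move=> oV hs q Vq; have [W [a [b [oW Wq WV e]]]] := hs _ Vq.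
exists ((fun q => tag (spec_germ q)) @^-1` W), (f a), (f b); split=> //.
- by move/continuousP: spec_continuous => /(_ _ oW).
- by move=> q' /WV.
- move=> q' /= Wq'; have [ba eb] := e _ Wq'; split=> //.
  exact: loc_mapP ba eb.
Qed.

Definition spec_hom : hom (spec S) (spec R) :=
  @Hom (spec S) (spec R) spec_germ spec_continuous
    (fun q => @loc_map_unit R S f q) spec_hom_sec.

End SpecHom.

(* Homomorphisms out of a localization are determined on the image of the ring. *)
Lemma spec_germ_eq (R : comNzRingType) (B : comNzRingType)
    (x y : {p : spec R & {rmorphism stalk p -> B}}) :
  tag x = tag y ->
  (forall a, tagged x (to_loc (tag x) a) = tagged y (to_loc (tag y) a)) -> x = y.
Proof.
case: x y => p f [q g] /= pq; subst q => fg.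
by congr existT; apply: loc_rmorph_eq.
Qed.

Lemma spec_hom_id (R : comNzRingType) (f : {rmorphism R -> R}) :
  f =1 id -> spec_hom f = hom_id.
Proof.
move=> fid; apply: hom_eq => q; apply: spec_germ_eq => /=.
  by apply: prime_ideal_eq => a; rewrite mem_preim_prime fid.
by move=> a; rewrite [LHS]loc_map_to_loc fid.
Qed.

Lemma spec_hom_comp (R S T : comNzRingType) (f : {rmorphism R -> S})
    (g : {rmorphism S -> T}) (h : {rmorphism R -> T}) :
  h =1 g \o f -> spec_hom h = spec_hom f \oS spec_hom g.
Proof.
move=> hE; apply: hom_eq => q; apply: spec_germ_eq => /=.
  by apply: prime_ideal_eq => a; rewrite !mem_preim_prime hE.
move=> a; rewrite [LHS]loc_map_to_loc hE.
rewrite -[RHS]/(@loc_map _ _ g q (@loc_map _ _ f (preim_prime g q) (to_loc _ a))).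
by rewrite !loc_map_to_loc.
Qed.

(* For a homeomorphism onto an open subset, being an isomorphism of sheaves is
   tested on stalks; likewise surjectivity for closed immersions. *)
Definition open_immersion (X Y : lrs) (j : hom X Y) : Prop :=
  [/\ injective j, forall U : set X, open U -> open (j @` U)
    & forall x, bijective (stalk_map j x)].

Definition closed_immersion (X Y : lrs) (i : hom X Y) : Prop :=
  [/\ injective i, forall C : set X, closed C -> closed (i @` C)
    & forall x b, exists a, stalk_map i x a = b].

Record scheme := Scheme {
  scheme_lrs :> lrs;
  affine_cover : forall x : scheme_lrs, exists (R : comNzRingType)
    (j : hom (spec R) scheme_lrs), open_immersion j /\ exists p, j p = x }.

Lemma open_immersion_id (X : lrs) : open_immersion (@hom_id X).
Proof.
split=> [//|U oU|x]; last by exists id.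
by rewrite (_ : hom_id @` U = U) // eqEsubset; split=> [_ [x Ux <-]|x Ux] //; exists x.
Qed.

Lemma spec_affine_cover (R : comNzRingType) (x : spec R) :
  exists (S : comNzRingType) (j : hom (spec S) (spec R)),
    open_immersion j /\ exists p, j p = x.
Proof. by exists R, hom_id; split; [exact: open_immersion_id | exists x]. Qed.

Definition Spec (R : comNzRingType) : scheme := Scheme (@spec_affine_cover R).

Definition is_pullback (X Y S P : scheme) (f : hom X S) (g : hom Y S)
    (p : hom P X) (q : hom P Y) : Prop :=
  f \oS p = g \oS q /\
  forall (Z : scheme) (a : hom Z X) (b : hom Z Y), f \oS a = g \oS b ->
    exists! h : hom Z P, p \oS h = a /\ q \oS h = b.

Record over (S : scheme) := Over { total :> scheme; str : hom total S }.

Record ohom (S : scheme) (X Y : over S) := OHom {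
  ohom_hom :> hom X Y;
  ohom_str : str Y \oS ohom_hom = str X }.

Section Over.
Variable S : scheme.
Implicit Types X Y Z T : over S.

Lemma ohom_eq X Y (f g : ohom X Y) : f = g :> hom X Y -> f = g.
Proof.
by case: f g => f e [g e'] /= fg; subst g; rewrite (Prop_irrelevance e e').
Qed.

Definition oid X : ohom X X := OHom (hom_comp1r (str X)).

Program Definition ocomp X Y Z (g : ohom Y Z) (f : ohom X Y) : ohom X Z :=
  @OHom S X Z ((g : hom Y Z) \oS (f : hom X Y)) _.
Next Obligation. by move=> X Y Z g f; rewrite hom_compA !ohom_str. Qed.

End Over.

Reserved Notation "g \oO f" (at level 50, left associativity, format "g  \oO  f").
Notation "g \oO f" := (ocomp g f).

Lemma ocompA (S : scheme) (X Y Z T : over S) (h : ohom Z T) (g : ohom Y Z) (f : ohom X Y) :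
  h \oO (g \oO f) = h \oO g \oO f.
Proof. by apply: ohom_eq; rewrite /= hom_compA. Qed.

(* A group structure on [G] is given as a group structure on the [T]-valued
   points, natural in [T].  Commutativity is automatic for abelian varieties. *)
Record group_scheme (S : scheme) := GroupScheme {
  group_over :> over S;
  gzero : forall T : over S, ohom T group_over;
  gopp : forall T : over S, ohom T group_over -> ohom T group_over;
  gadd : forall T : over S, ohom T group_over -> ohom T group_over -> ohom T group_over;
  gaddA : forall T, associative (@gadd T);
  gaddC : forall T, commutative (@gadd T);
  gadd0 : forall T, left_id (gzero T) (@gadd T);
  gaddN : forall T, left_inverse (gzero T) (@gopp T) (@gadd T);
  gadd_natural : forall (T T' : over S) (h : ohom T' T) (x y : ohom T group_over),
    gadd x y \oO h = gadd (x \oO h) (y \oO h) }.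

Definition points (S : scheme) (G : group_scheme S) (T : over S) := ohom T G.

HB.instance Definition _ (S : scheme) (G : group_scheme S) (T : over S) :
  hasDecEq (points G T) := gen_eqMixin (points G T).
HB.instance Definition _ (S : scheme) (G : group_scheme S) (T : over S) :
  hasChoice (points G T) := gen_choiceMixin (points G T).
HB.instance Definition _ (S : scheme) (G : group_scheme S) (T : over S) :=
  GRing.isZmodule.Build (points G T) (@gaddA S G T) (@gaddC S G T) (@gadd0 S G T) (@gaddN S G T).

Section Homomorphisms.
Variable S : scheme.
Implicit Types (G H : group_scheme S) (T : over S).

Definition group_hom G H (f : ohom G H) : Prop :=
  forall T (x y : points G T), (f \oO (x + y) : points H T) = (f \oO x : points H T) + (f \oO y).

Lemma pointsD_comp G T T' (h : ohom T' T) (x y : points G T) :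
  ((x + y) \oO h : points G T') = (x \oO h : points G T') + (y \oO h).
Proof. exact: gadd_natural. Qed.

Lemma points0_comp G T T' (h : ohom T' T) :
  ((0 : points G T) \oO h : points G T') = 0.
Proof.
apply: (addIr ((0 : points G T) \oO h : points G T')).
by rewrite -pointsD_comp !add0r.
Qed.

Lemma pointsN_comp G T T' (h : ohom T' T) (x : points G T) :
  ((- x) \oO h : points G T') = - (x \oO h : points G T').
Proof.
apply: (addIr (x \oO h : points G T')).
by rewrite -pointsD_comp !addNr points0_comp.
Qed.

Record endo G := Endo { endo_hom :> ohom G G; endoP : group_hom endo_hom }.

Lemma endo_eq G (f g : endo G) : endo_hom f = endo_hom g -> f = g.
Proof.
by case: f g => f e [g e'] /= fg; subst g; rewrite (Prop_irrelevance e e').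
Qed.

Section EndoRing.
Variable G : group_scheme S.
Implicit Types f g h : endo G.

Definition endo_point f : points G G := endo_hom f.

Lemma endo_add_subproof f g : group_hom (endo_point f + endo_point g).
Proof.
move=> T x y.
by rewrite !pointsD_comp [in LHS]/endo_point (endoP f) (endoP g) addrACA.
Qed.

Lemma endo_opp_subproof f : group_hom (- endo_point f).
Proof. by move=> T x y; rewrite !pointsN_comp [in LHS]/endo_point (endoP f) opprD. Qed.

Lemma endo_zero_subproof : group_hom (0 : points G G).
Proof. by move=> T x y; rewrite !points0_comp addr0. Qed.

Lemma endo_one_subproof : group_hom (oid G).
Proof.
have idE T (z : points G T) : oid G \oO z = z by apply: ohom_eq; rewrite /= hom_comp1l.
by move=> T x y; rewrite !idE.
Qed.

Lemma endo_mul_subproof f g : group_hom (endo_hom f \oO endo_hom g).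
Proof. by move=> T x y; rewrite -!ocompA (endoP g) (endoP f). Qed.

Definition endo_add f g : endo G := Endo (endo_add_subproof f g).
Definition endo_opp f : endo G := Endo (endo_opp_subproof f).
Definition endo_zero : endo G := Endo endo_zero_subproof.
Definition endo_one : endo G := Endo endo_one_subproof.
Definition endo_mul f g : endo G := Endo (endo_mul_subproof f g).

Lemma endo_addA : associative endo_add.
Proof. by move=> f g h; apply: endo_eq; exact: (@addrA (points G G)). Qed.
Lemma endo_addC : commutative endo_add.
Proof. by move=> f g; apply: endo_eq; exact: (@addrC (points G G)). Qed.
Lemma endo_add0 : left_id endo_zero endo_add.
Proof. by move=> f; apply: endo_eq; exact: (@add0r (points G G)). Qed.
Lemma endo_addN : left_inverse endo_zero endo_opp endo_add.
Proof. by move=> f; apply: endo_eq; exact: (@addNr (points G G)). Qed.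
Lemma endo_mulA : associative endo_mul.
Proof. by move=> f g h; apply: endo_eq; exact: ocompA. Qed.
Lemma endo_mul1 : left_id endo_one endo_mul.
Proof. by move=> f; apply: endo_eq; apply: ohom_eq; rewrite /= hom_comp1l. Qed.
Lemma endo_mulr1 : right_id endo_one endo_mul.
Proof. by move=> f; apply: endo_eq; apply: ohom_eq; rewrite /= hom_comp1r. Qed.
Lemma endo_mulDl : left_distributive endo_mul endo_add.
Proof.
by move=> f g h; apply: endo_eq; exact: (pointsD_comp h (endo_point f) (endo_point g)).
Qed.
Lemma endo_mulDr : right_distributive endo_mul endo_add.
Proof. by move=> f g h; apply: endo_eq; exact: (endoP f (endo_point g) (endo_point h)). Qed.

HB.instance Definition _ : hasDecEq (endo G) := gen_eqMixin (endo G).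
HB.instance Definition _ : hasChoice (endo G) := gen_choiceMixin (endo G).
HB.instance Definition _ := GRing.isPzRing.Build (endo G)
  endo_addA endo_addC endo_add0 endo_addN endo_mulA endo_mul1 endo_mulr1
  endo_mulDl endo_mulDr.

End EndoRing.
End Homomorphisms.

(* Fibre products are not chosen: a condition on a fibre product is imposed on
   every pullback, which is harmless as pullbacks are unique up to isomorphism. *)
Definition separated_over (S : scheme) (X : over S) : Prop :=
  forall (P : scheme) (p q : hom P X) (diag : hom X P),
    is_pullback (str X) (str X) p q ->
    p \oS diag = hom_id -> q \oS diag = hom_id -> closed_immersion diag.

Definition universally_closed_over (S : scheme) (X : over S) : Prop :=
  forall (T P : scheme) (t : hom T S) (p : hom P X) (q : hom P T),
    is_pullback (str X) t p q -> forall C : set P, closed C -> closed (q @` C).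

Definition finitely_generated (R B : comNzRingType) (f : {rmorphism R -> B}) : Prop :=
  exists s : seq B, forall C : {pred B}, subring_closed C ->
    (forall c, f c \in C) -> {subset s <= C} -> forall b, b \in C.

Definition finite_type (k : fieldType) (X : over (Spec k)) : Prop :=
  exists (n : nat) (R : 'I_n -> comNzRingType) (f : forall i, {rmorphism k -> R i})
    (j : forall i, hom (Spec (R i)) X),
    (forall i, [/\ finitely_generated (f i), open_immersion (j i)
                 & str X \oS j i = spec_hom (f i)]) /\
    (forall x : X, exists i p, j i p = x).

Definition proper_over (k : fieldType) (X : over (Spec k)) : Prop :=
  [/\ separated_over X, finite_type X & universally_closed_over X].

Definition integral_scheme (X : scheme) : Prop :=
  (exists x : X, True) /\
  forall (U : set X) s t, open U -> U !=set0 -> sec U s -> sec U t ->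
    (forall x, U x -> s x * t x = 0) ->
    (forall x, U x -> s x = 0) \/ (forall x, U x -> t x = 0).

Definition geometrically_integral (k : fieldType) (X : over (Spec k)) : Prop :=
  forall (k' : fieldType) (f : {rmorphism k -> k'}) (P : scheme)
    (p : hom P X) (q : hom P (Spec k')),
    is_pullback (str X) (spec_hom f : hom (Spec k') (Spec k)) p q -> integral_scheme P.

(* A proper, geometrically integral group scheme over a field; smoothness is a
   consequence. *)
Record abelian_variety (k : fieldType) := AbelianVariety {
  av_group :> group_scheme (Spec k);
  av_proper : proper_over av_group;
  av_geometrically_integral : geometrically_integral av_group }.

Definition over_comp (S S' : scheme) (f : hom S' S) (T : over S') : over S :=
  Over (f \oS str T).

Record base_change (S S' : scheme) (f : hom S' S) (X : over S) := BaseChange {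
  bc :> over S';
  bc_pr : hom bc X;
  bcP : is_pullback (str X) f bc_pr (str bc) }.

Section BaseChange.
Variables (S S' : scheme) (f : hom S' S).

Section Lift.
Variables (X : over S) (B : base_change f X).

Definition bc_lift (Z : scheme) (a : hom Z X) (b : hom Z S')
    (e : str X \oS a = f \oS b) : hom Z B :=
  sval (cid ((bcP B).2 Z a b e)).

Lemma bc_lift_pr Z a b e : bc_pr B \oS @bc_lift Z a b e = a.
Proof. by rewrite /bc_lift; case: cid => h [[]]. Qed.

Lemma bc_lift_str Z a b e : str B \oS @bc_lift Z a b e = b.
Proof. by rewrite /bc_lift; case: cid => h [[]]. Qed.

Lemma bc_hom_eq (Z : scheme) (h h' : hom Z B) :
  bc_pr B \oS h = bc_pr B \oS h' -> str B \oS h = str B \oS h' -> h = h'.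
Proof.
move=> e1 e2; have e : str X \oS (bc_pr B \oS h) = f \oS (str B \oS h).
  by rewrite !hom_compA (bcP B).1.
have [h0 [_ u]] := (bcP B).2 Z _ _ e.
by rewrite -(u h) // -(u h').
Qed.

Lemma bc_ohom_eq (T : over S') (x y : ohom T B) :
  bc_pr B \oS x = bc_pr B \oS y -> x = y.
Proof. by move=> e; apply/ohom_eq/bc_hom_eq => //; rewrite !ohom_str. Qed.

Lemma of_bc_subproof (T : over S') (x : ohom T B) :
  str X \oS (bc_pr B \oS x) = str (over_comp f T).
Proof. by rewrite hom_compA (bcP B).1 -hom_compA ohom_str. Qed.

Definition of_bc (T : over S') (x : ohom T B) : ohom (over_comp f T) X :=
  @OHom S (over_comp f T) X (bc_pr B \oS x) (of_bc_subproof x).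

Definition to_bc (T : over S') (x : ohom (over_comp f T) X) : ohom T B :=
  @OHom S' T B (bc_lift (ohom_str x)) (bc_lift_str (ohom_str x)).

Lemma of_bcK T : cancel (@of_bc T) (@to_bc T).
Proof. by move=> x; apply: bc_ohom_eq; rewrite /= bc_lift_pr. Qed.

Lemma to_bcK T : cancel (@to_bc T) (@of_bc T).
Proof. by move=> x; apply: ohom_eq; rewrite /= bc_lift_pr. Qed.

End Lift.

Lemma over_comp_hom_subproof (T T' : over S') (h : ohom T' T) :
  str (over_comp f T) \oS h = str (over_comp f T').
Proof. by rewrite /= -hom_compA ohom_str. Qed.

Definition over_comp_hom (T T' : over S') (h : ohom T' T) :
  ohom (over_comp f T') (over_comp f T) :=
  @OHom S (over_comp f T') (over_comp f T) h (over_comp_hom_subproof h).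

Definition bc_map (X Y : over S) (BX : base_change f X) (BY : base_change f Y)
    (h : ohom X Y) : ohom BX BY :=
  to_bc BY (h \oO of_bc (oid BX)).

Lemma bc_map_pr X Y (BX : base_change f X) (BY : base_change f Y) (h : ohom X Y) :
  bc_pr BY \oS bc_map BX BY h = h \oS bc_pr BX.
Proof. by rewrite /= bc_lift_pr /= hom_comp1r. Qed.

(* The group scheme G x_S S': its T-points are the points of [G] in [T]
   regarded as an [S]-scheme. *)
Section BaseChangeGroup.
Variables (G : group_scheme S) (B : base_change f G).

Let dn (T : over S') (x : ohom T B) : points G (over_comp f T) := of_bc x.
Let up (T : over S') (x : points G (over_comp f T)) : ohom T B := to_bc B x.

Definition bc_add T x y := @up T (dn x + dn y).
Definition bc_opp T x := @up T (- dn x).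
Definition bc_zero T := @up T 0.

Let upK T : cancel (@up T) (@dn T). Proof. exact: to_bcK. Qed.
Let dnK T : cancel (@dn T) (@up T). Proof. exact: of_bcK. Qed.

Lemma bc_addA T : associative (@bc_add T).
Proof. by move=> x y z; rewrite /bc_add !upK addrA. Qed.
Lemma bc_addC T : commutative (@bc_add T).
Proof. by move=> x y; rewrite /bc_add addrC. Qed.
Lemma bc_add0 T : left_id (@bc_zero T) (@bc_add T).
Proof. by move=> x; rewrite /bc_add upK add0r dnK. Qed.
Lemma bc_addN T : left_inverse (@bc_zero T) (@bc_opp T) (@bc_add T).
Proof. by move=> x; rewrite /bc_add upK addNr. Qed.

Lemma bc_add_natural (T T' : over S') (h : ohom T' T) (x y : ohom T B) :
  bc_add x y \oO h = bc_add (x \oO h) (y \oO h).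
Proof.
have dnE z : dn (z \oO h) = dn z \oO over_comp_hom h.
  by apply: ohom_eq; rewrite /= hom_compA.
apply: (can_inj (@dnK _)); rewrite dnE /bc_add !upK !dnE.
exact: pointsD_comp.
Qed.

Definition bc_group : group_scheme S' :=
  @GroupScheme S' B bc_zero bc_opp bc_add bc_addA bc_addC bc_add0 bc_addN bc_add_natural.

Lemma of_bcD T (x y : points bc_group T) : dn (x + y) = dn x + dn y.
Proof. exact: upK. Qed.

End BaseChangeGroup.
End BaseChange.

(* A homomorphism from [H] to the ring automorphisms of [L]. *)
Record ring_action (H : finGroupType) (L : pzRingType) := RingAction {
  ract :> H -> L -> L;
  ract_zmod : forall h, zmod_morphism (ract h);
  ract_monoid : forall h, monoid_morphism (ract h);
  ract1 : forall a, ract 1%g a = a;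
  ractM : forall g h a, ract (g * h)%g a = ract g (ract h a) }.

Definition skew_ring (H : finGroupType) (L : pzRingType) (t : ring_action H L) :=
  {ffun H -> L}.

Section SkewRing.
Variables (H : finGroupType) (L : pzRingType) (t : ring_action H L).
Implicit Types x y z : skew_ring t.

HB.instance Definition _ := GRing.Zmodule.on (skew_ring t).

Definition skew_one : skew_ring t := [ffun r => if r == 1%g then 1 else 0].
Definition skew_mul x y : skew_ring t :=
  [ffun r => \sum_(p : H * H | (p.1 * p.2)%g == r) x p.1 * t p.1 (y p.2)].

Lemma ract0 h : t h 0 = 0.
Proof. by have := ract_zmod t h 0 0; rewrite !subrr. Qed.

Lemma ractD h : {morph t h : a b / a + b}.
Proof.
move=> a b; have tN c : t h (- c) = - t h c by rewrite -sub0r ract_zmod ract0 sub0r.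
by rewrite -{1}[b]opprK ract_zmod tN opprK.
Qed.

Lemma ract_sum h (I : finType) (P : pred I) (F : I -> L) :
  t h (\sum_(i | P i) F i) = \sum_(i | P i) t h (F i).
Proof. by rewrite (big_morph (t h) (ractD h) (ract0 h)). Qed.

Lemma ractMr h a b : t h (a * b) = t h a * t h b.
Proof. by have [_ ->] := ract_monoid t h. Qed.

Lemma skew_mulE x y r : skew_mul x y r = \sum_g x g * t g (y (g^-1 * r)%g).
Proof.
rewrite ffunE (eq_bigl (fun p : H * H => true && (p.1 * p.2 == r)%g)) //.
rewrite -(pair_big_dep xpredT (fun g h => (g * h == r)%g) (fun g h => x g * t g (y h))) /=.
apply: eq_bigr => g _; rewrite (big_pred1 (g^-1 * r)%g) // => h.
by rewrite -(inj_eq (mulgI g^-1%g)) mulKg.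
Qed.

Lemma skew_mulA : associative skew_mul.
Proof.
move=> x y z; apply/ffunP => r; rewrite !skew_mulE.
transitivity (\sum_g \sum_h x g * t g (y (g^-1 * h)%g) * t h (z (h^-1 * r)%g)).
  apply: eq_bigr => g _; rewrite skew_mulE ract_sum mulr_sumr.
  rewrite [RHS](reindex (fun h => g * h)%g); last first.
    by exists (fun h => g^-1 * h)%g => h _; rewrite ?mulKg ?mulKVg.
  by apply: eq_bigr => h _; rewrite mulKg ractMr mulrA -ractM invMg mulgA.
rewrite exchange_big; apply: eq_bigr => h _.
by rewrite skew_mulE mulr_suml.
Qed.

Lemma skew_mul1 : left_id skew_one skew_mul.
Proof.
move=> x; apply/ffunP => r; rewrite skew_mulE (bigD1 1%g) //= big1 ?addr0.
  by rewrite ffunE eqxx mul1r ract1 invg1 mul1g.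
by move=> g /negbTE g1; rewrite ffunE g1 mul0r.
Qed.

Lemma skew_mulr1 : right_id skew_one skew_mul.
Proof.
move=> x; apply/ffunP => r; rewrite skew_mulE (bigD1 r) //= big1 ?addr0.
  by rewrite mulVg ffunE eqxx (ract_monoid t r).1 mulr1.
move=> g gr; rewrite ffunE ifN ?ract0 ?mulr0 //.
by apply: contraNneq gr => /(congr1 (fun h => g * h)%g); rewrite mulKVg mulg1 => ->.
Qed.

Lemma skew_mulDl : left_distributive skew_mul +%R.
Proof.
move=> x y z; apply/ffunP => r; rewrite !(skew_mulE, ffunE) -big_split /=.
by apply: eq_bigr => g _; rewrite ffunE mulrDl.
Qed.

Lemma skew_mulDr : right_distributive skew_mul +%R.
Proof.
move=> x y z; apply/ffunP => r; rewrite !(skew_mulE, ffunE).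
by rewrite -[RHS]big_split; apply: eq_bigr => g _; rewrite ffunE ractD mulrDr.
Qed.

HB.instance Definition _ := GRing.Zmodule_isPzRing.Build (skew_ring t)
  skew_mulA skew_mul1 skew_mulr1 skew_mulDl skew_mulDr.

End SkewRing.

Definition Spec_ext (k : fieldType) (K : splittingFieldType k) : hom (Spec K) (Spec k) :=
  spec_hom (in_alg K).

(* A choice of the fibre product [X x_k Spec K] for every [k]-scheme [X]: these
   exist by the usual gluing argument and are unique up to isomorphism. *)
Definition base_changes (k : fieldType) (K : splittingFieldType k) :=
  forall X : over (Spec k), base_change (Spec_ext K) X.

Section Weil.
Variables (k : fieldType) (K : splittingFieldType k) (BC : base_changes K).
Implicit Types (X Z : over (Spec k)) (s : gal_of {:K}).

Definition scalar_ext X Z (h : ohom X Z) : ohom (BC X) (BC Z) := bc_map (BC X) (BC Z) h.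

(* [weil] represents the functor [Z |-> A'(Z_K)] to abelian groups, with
   universal element [weil_univ]. *)
Record weil_restriction (A' : group_scheme (Spec K)) := WeilRestriction {
  weil :> abelian_variety k;
  weil_univ : ohom (BC weil) A';
  weil_bij : forall Z, bijective
    (fun x : points weil Z => weil_univ \oO scalar_ext x : points A' (BC Z));
  weil_additive : forall Z, zmod_morphism
    (fun x : points weil Z => weil_univ \oO scalar_ext x : points A' (BC Z)) }.

(* The product in [gal_of] is [(s * t) a = t (s a)], so [s |-> Spec s] is a
   group isomorphism from [gal_of {:K}] to the automorphisms of [Spec K] over
   [Spec k]: with this product, [gal_of {:K}] is the opposite of the Galois
   group for the composition of field automorphisms. *)
Definition Spec_gal s : hom (Spec K) (Spec K) := spec_hom (s : {rmorphism K -> K}).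

Lemma Spec_gal1 : Spec_gal 1%g = hom_id.
Proof. by apply: spec_hom_id => a; exact: gal_id. Qed.

Lemma Spec_galM s t : Spec_gal (s * t)%g = Spec_gal s \oS Spec_gal t.
Proof. by apply: spec_hom_comp => a; apply: galM; apply: memvf. Qed.

Lemma Spec_gal_ext s : Spec_ext K \oS Spec_gal s = Spec_ext K.
Proof.
symmetry; apply: spec_hom_comp => a.
by rewrite /= linearZ /= rmorph1.
Qed.

Lemma twist_subproof X s :
  str X \oS bc_pr (BC X) = Spec_ext K \oS (Spec_gal s \oS str (BC X)).
Proof. by rewrite hom_compA Spec_gal_ext (bcP (BC X)).1. Qed.

(* [id_X x Spec s] *)
Definition twist X s : hom (BC X) (BC X) := bc_lift (BC X) (twist_subproof X s).

Lemma twist_pr X s : bc_pr (BC X) \oS twist X s = bc_pr (BC X).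
Proof. exact: bc_lift_pr. Qed.

Lemma twist_str X s : str (BC X) \oS twist X s = Spec_gal s \oS str (BC X).
Proof. exact: bc_lift_str. Qed.

Lemma twist1 X : twist X 1%g = hom_id.
Proof.
by apply: bc_hom_eq; rewrite ?twist_pr ?twist_str ?Spec_gal1 ?hom_comp1r ?hom_comp1l.
Qed.

Lemma twistM X s t : twist X (s * t)%g = twist X s \oS twist X t.
Proof.
apply: bc_hom_eq; first by rewrite hom_compA !twist_pr.
by rewrite hom_compA !twist_str Spec_galM -!hom_compA twist_str.
Qed.

Lemma twistVK X s : twist X s \oS twist X s^-1%g = hom_id.
Proof. by rewrite -twistM mulgV twist1. Qed.

Lemma twistKV X s : twist X s^-1%g \oS twist X s = hom_id.
Proof. by rewrite -twistM mulVg twist1. Qed.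

Lemma galact_subproof X Z s (P : ohom (BC Z) (BC X)) :
  str (BC X) \oS (twist X s \oS P \oS twist Z s^-1%g) = str (BC Z).
Proof.
rewrite !hom_compA twist_str -[_ \oS str _ \oS P]hom_compA ohom_str.
by rewrite -hom_compA twist_str hom_compA -Spec_galM mulgV Spec_gal1 hom_comp1l.
Qed.

Definition galact X Z s (P : ohom (BC Z) (BC X)) : ohom (BC Z) (BC X) :=
  OHom (galact_subproof s P).

Lemma galact1 X Z (P : ohom (BC Z) (BC X)) : galact 1%g P = P.
Proof. by apply: ohom_eq; rewrite /= invg1 !twist1 hom_comp1l hom_comp1r. Qed.

Lemma galactM X Z s t (P : ohom (BC Z) (BC X)) : galact (s * t)%g P = galact s (galact t P).
Proof. by apply: ohom_eq; rewrite /= invMg !twistM !hom_compA. Qed.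

Lemma galact_comp X Y Z s (P : ohom (BC Y) (BC X)) (Q : ohom (BC Z) (BC Y)) :
  galact s (P \oO Q) = galact s P \oO galact s Q.
Proof.
apply: ohom_eq => /=; rewrite !hom_compA.
by rewrite -[_ \oS twist Y s^-1%g \oS twist Y s]hom_compA twistKV hom_comp1r.
Qed.

Lemma twist_scalar_ext X Z s (h : ohom X Z) :
  twist Z s \oS scalar_ext h = scalar_ext h \oS twist X s.
Proof.
apply: bc_hom_eq; first by rewrite !hom_compA twist_pr !bc_map_pr -hom_compA twist_pr.
by rewrite !hom_compA twist_str -hom_compA !ohom_str twist_str.
Qed.

Lemma galact_scalar_ext X Z s (h : ohom X Z) : galact s (scalar_ext h) = scalar_ext h.
Proof.
by apply: ohom_eq; rewrite /= twist_scalar_ext -hom_compA twistVK hom_comp1r.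
Qed.

Lemma scalar_ext_pr X Z (h : ohom X Z) :
  bc_pr (BC Z) \oS scalar_ext h = h \oS bc_pr (BC X).
Proof. exact: bc_map_pr. Qed.

Lemma scalar_ext_id X : scalar_ext (oid X) = oid (BC X).
Proof. by apply: bc_ohom_eq; rewrite scalar_ext_pr /= hom_comp1l hom_comp1r. Qed.

Lemma scalar_ext_comp X Y Z (g : ohom Y Z) (h : ohom X Y) :
  scalar_ext (g \oO h) = scalar_ext g \oO scalar_ext h.
Proof.
apply: bc_ohom_eq; rewrite scalar_ext_pr.
transitivity (g \oS h \oS bc_pr (BC X)); first by [].
by rewrite -hom_compA -scalar_ext_pr hom_compA -scalar_ext_pr -hom_compA.
Qed.

Definition gext (A : group_scheme (Spec k)) : group_scheme (Spec K) :=
  bc_group (BC A).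

Section Action.
Variable A : group_scheme (Spec k).
Let AK := gext A.

Let twisted s (T : over (Spec K)) : over (Spec K) := Over (Spec_gal s \oS str T).

Lemma untwist_subproof s T :
  str (over_comp (Spec_ext K) T) \oS hom_id =
  str (over_comp (Spec_ext K) (twisted s T)).
Proof. by rewrite hom_comp1r /= hom_compA Spec_gal_ext. Qed.

Let untwist s T : ohom (over_comp (Spec_ext K) (twisted s T)) (over_comp (Spec_ext K) T) :=
  @OHom _ (over_comp (Spec_ext K) (twisted s T)) (over_comp (Spec_ext K) T) hom_id
    (untwist_subproof s T).

Lemma twist_point_subproof s T (x : points AK T) :
  str AK \oS (twist A s \oS x) = str (twisted s T).
Proof. by rewrite hom_compA twist_str -hom_compA ohom_str. Qed.

Let twist_point s T (x : points AK T) : points AK (twisted s T) :=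
  @OHom _ (twisted s T) AK (twist A s \oS x) (twist_point_subproof s x).

Let dn T (x : points AK T) : points A (over_comp (Spec_ext K) T) := of_bc x.

Let dnD T (x y : points AK T) : dn (x + y) = dn x + dn y.
Proof. exact: of_bcD. Qed.

Let dn_inj T : injective (@dn T).
Proof. exact: can_inj (@of_bcK _ _ _ _ (BC A) T). Qed.

Let dn_twist s T (x : points AK T) : dn (twist_point s x) = dn x \oO untwist s T.
Proof. by apply: ohom_eq; rewrite /= hom_compA twist_pr hom_comp1r. Qed.

Let twist_pointD s T (x y : points AK T) :
  twist_point s (x + y) = twist_point s x + twist_point s y.
Proof.
by apply: dn_inj; rewrite dnD !dn_twist dnD; exact: pointsD_comp.
Qed.

Lemma galact_endo_subproof s (l : endo AK) : group_hom (galact s l : ohom AK AK).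
Proof.
have dnE T (x : points AK T) :
    dn (endo_hom l \oO twist_point s^-1%g x) =
    dn (galact s l \oO x) \oO untwist s^-1%g T.
  by apply: ohom_eq; rewrite /= hom_comp1r !hom_compA twist_pr.
move=> T x y; apply: dn_inj; rewrite dnD.
have cancel_untwist (u v : ohom (over_comp (Spec_ext K) T) A) :
    u \oO untwist s^-1%g T = v \oO untwist s^-1%g T -> u = v.
  move=> h; apply: ohom_eq; rewrite -[LHS]hom_comp1r -[RHS]hom_comp1r.
  exact: (congr1 (@ohom_hom _ _ _) h).
apply: cancel_untwist; rewrite -dnE twist_pointD (endoP l) dnD !dnE.
by symmetry; exact: pointsD_comp.
Qed.

Definition galact_endo s (l : endo AK) : endo AK := Endo (galact_endo_subproof s l).

Lemma galactD Z s (x y : points AK (BC Z)) :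
  (galact s (x + y) : points AK (BC Z)) = (galact s x : points AK (BC Z)) + galact s y.
Proof.
have str_twist : str (over_comp (Spec_ext K) (BC Z)) \oS twist Z s^-1%g =
                 str (over_comp (Spec_ext K) (BC Z)).
  by rewrite /= -hom_compA twist_str hom_compA Spec_gal_ext.
pose e := @OHom _ (over_comp (Spec_ext K) (BC Z)) (over_comp (Spec_ext K) (BC Z))
  (twist Z s^-1%g) str_twist.
have dnE (z : points AK (BC Z)) : dn (galact s z) = dn z \oO e.
  by apply: ohom_eq; rewrite /= !hom_compA twist_pr.
by apply: dn_inj; rewrite dnD !dnE dnD; exact: pointsD_comp.
Qed.

Lemma galact_endo_zmod s : zmod_morphism (galact_endo s).
Proof.
have gD : {morph galact_endo s : l m / l + m}.
  by move=> l m; apply: endo_eq; exact: galactD.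
move=> l m; apply: (addIr (galact_endo s m)).
by rewrite -gD !subrK.
Qed.

Lemma galact_endo_monoid s : monoid_morphism (galact_endo s).
Proof.
split.
  by apply: endo_eq; apply: ohom_eq; rewrite /= hom_comp1r twistVK.
by move=> l m; apply: endo_eq; exact: galact_comp.
Qed.

Lemma galact_endo1 l : galact_endo 1%g l = l.
Proof. by apply: endo_eq; exact: galact1. Qed.

Lemma galact_endoM s t l : galact_endo (s * t)%g l = galact_endo s (galact_endo t l).
Proof. by apply: endo_eq; exact: galactM. Qed.

Definition gal_action : ring_action (gal_of {:K}) (endo AK) :=
  RingAction galact_endo_zmod galact_endo_monoid galact_endo1 galact_endoM.

End Action.

Section Restriction.
Variables (A' : group_scheme (Spec K)) (W : weil_restriction A').

Definition weil_eval Z (x : points W Z) : points A' (BC Z) :=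
  weil_univ W \oO scalar_ext x.

Lemma weil_eval_inj Z : injective (@weil_eval Z).
Proof. exact: bij_inj (weil_bij W Z). Qed.

Lemma weil_evalD Z (x y : points W Z) : weil_eval (x + y) = weil_eval x + weil_eval y.
Proof.
have := @weil_additive _ W Z (x + y) y; rewrite addrK -!/(weil_eval _) => /eqP.
by rewrite eq_sym subr_eq => /eqP.
Qed.

Lemma weil_eval_comp Z Z' (x : points W Z) (h : ohom Z' Z) :
  weil_eval (x \oO h) = weil_eval x \oO scalar_ext h.
Proof. by rewrite /weil_eval scalar_ext_comp ocompA. Qed.

Lemma weil_id : weil_eval (oid W) = weil_univ W.
Proof.
rewrite /weil_eval scalar_ext_id; apply: ohom_eq; exact: hom_comp1r.
Qed.

(* An additive endomorphism of the functor represented by [W], natural in [Z],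
   comes from a unique endomorphism of [W]. *)
Lemma weil_endo_exists (F : forall Z, points A' (BC Z) -> points A' (BC Z)) :
  (forall Z x y, F Z (x + y) = F Z x + F Z y) ->
  (forall Z Z' (x : points A' (BC Z)) (h : ohom Z' Z),
     F Z' (x \oO scalar_ext h) = F Z x \oO scalar_ext h) ->
  exists e : endo W, forall Z (x : points W Z), weil_eval (endo_hom e \oO x) = F Z (weil_eval x).
Proof.
move=> FD Fnat; have [g _ gK] := weil_bij W W.
pose e : points W W := g (F _ (weil_univ W)).
have eE Z (x : points W Z) : weil_eval (e \oO x) = F Z (weil_eval x).
  rewrite weil_eval_comp [weil_eval e]gK -Fnat -weil_id -weil_eval_comp.
  by congr (F _ (weil_eval _)); apply: ohom_eq; rewrite /= hom_comp1l.
have e_hom : group_hom e.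
  by move=> Z x y; apply: weil_eval_inj; rewrite weil_evalD !eE weil_evalD FD.
by exists (Endo e_hom).
Qed.

Lemma weil_endo_uniq (e e' : endo W) :
  weil_univ W \oO scalar_ext e = weil_univ W \oO scalar_ext e' -> e = e'.
Proof. by move=> h; apply: endo_eq; exact: (@weil_eval_inj W). Qed.

Lemma weil_res_exists (l : endo A') :
  exists e : endo W, weil_univ W \oO scalar_ext e = endo_hom l \oO weil_univ W.
Proof.
have [|Z Z' x h|e eE] :=
  @weil_endo_exists (fun Z x => endo_hom l \oO x : points A' (BC Z)).
- by move=> Z x y; exact: endoP.
- by rewrite ocompA.
exists e; have := eE _ (oid W); rewrite weil_id => <-.
rewrite /weil_eval; congr (_ \oO scalar_ext _).
by apply: ohom_eq; rewrite /= hom_comp1r.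
Qed.

(* The endomorphism with [u o Res(l)_K = l o u]. *)
Definition weil_res (l : endo A') : endo W := sval (cid (weil_res_exists l)).

Lemma weil_resP l : weil_univ W \oO scalar_ext (weil_res l) = endo_hom l \oO weil_univ W.
Proof. by rewrite /weil_res; case: cid. Qed.

End Restriction.

Section GaloisRestriction.
Variables (A : group_scheme (Spec k)) (W : weil_restriction (gext A)).

Lemma weil_gal_exists s : exists e : endo W, forall Z (x : points W Z),
  weil_eval (endo_hom e \oO x) = galact s (weil_eval x).
Proof.
apply: (@weil_endo_exists _ W (fun Z x => galact s x : points (gext A) (BC Z))).
  by move=> Z x y; exact: galactD.
by move=> Z Z' x h; rewrite galact_comp galact_scalar_ext.
Qed.

(* The endomorphism of [W] induced by the automorphism [P |-> s(P)] of the
   functor [Z |-> A_K(Z_K)]. *)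
Definition weil_gal s : endo W := sval (cid (weil_gal_exists s)).

Lemma weil_galP s Z (x : points W Z) :
  weil_eval (endo_hom (weil_gal s) \oO x) = galact s (weil_eval x).
Proof. by move: Z x; rewrite /weil_gal; case: cid. Qed.

End GaloisRestriction.

End Weil.

(* Main.v *)
From Pilot Require Import Defs.
From HB Require Import structures.
From mathcomp Require Import all_boot all_order all_algebra all_fingroup.
From mathcomp Require Import all_solvable all_field.
From mathcomp Require Import boolp classical_sets topology_structure.
(* Restores [hom], which vector.v shadows. *)
Import Pilot.Defs.

(** Let u : W_K -> A_K be the universal element. The theorem reduces to the fact
    that the conjugates s(u) exhibit W_K as the product of copies of A_K indexed
    by the Galois group, naturally in T-valued points for T over K. A T-valued
    point of W_K is a morphism P : T x_k K -> A_K, and s(u) applied to that point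
    is the restriction of s(P) to the canonical section of T x_k K -> T. Since K|k
    is Galois, T x_k K is the disjoint union of the Galois translates of this
    section: two homomorphisms from K to a local ring that agree on k differ by
    a unique Galois automorphism, which is locally constant on T x_k K. So P is
    determined by, and can be glued from, arbitrary values of the s(u).
    With i_t : A_K -> W_K such that s(u) i_t = delta_{s,t}, the inverse of the map
    sends e to the family of the u e_K i_t. *)

Set Implicit Arguments.
Unset Strict Implicit.
Unset Printing Implicit Defensive.
Import GRing.Theory.
Local Open Scope ring_scope.

(** * Roots in local rings *)

Section LocalRing.
Variable B : comNzRingType.
Hypothesis local_B : forall a b : B, invertible (a + b) -> invertible a \/ invertible b.

Lemma not_invertible0 : ~ invertible (0 : B).
Proof. by case=> b /eqP; rewrite mul0r eq_sym oner_eq0. Qed.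

Lemma invertibleN (a : B) : invertible a -> invertible (- a).
Proof. by case=> b ab; exists (- b); rewrite mulrNN. Qed.

Lemma invertible_prod (I : eqType) (r : seq I) (P : pred I) (F : I -> B) :
  {in r, forall i, P i -> invertible (F i)} -> invertible (\prod_(i <- r | P i) F i).
Proof.
move=> rF; rewrite big_seq_cond; apply: big_rec; first exact: invertible1.
by move=> i x /andP[ri Pi]; apply: invertibleM; exact: rF.
Qed.

(* The differences [x - b] cannot all be units; if [x - b] is not one, then all
   the others are. *)
Lemma local_ring_root (r : seq B) (x : B) : uniq r ->
  {in r &, forall b c, b != c -> invertible (b - c)} ->
  \prod_(b <- r) (x - b) = 0 -> x \in r.
Proof.
move=> r_uniq r_sep prod0.
have [b rb xb] : exists2 b, b \in r & ~ invertible (x - b).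
  apply: contrapT => h; apply: not_invertible0; rewrite -prod0.
  by apply: invertible_prod => b rb _; apply: contrapT => xb; apply: h; exists b.
suff /eqP : x - b = 0 by rewrite subr_eq0 => /eqP ->.
apply: (@invertible_mulI _ (\prod_(c <- r | c != b) (x - c))).
  apply: invertible_prod => c rc cb.
  have : invertible ((x - c) + (b - x)).
    by rewrite addrC addrA subrK; apply: r_sep; rewrite // eq_sym.
  by case/local_B => // /invertibleN; rewrite opprB.
by rewrite mulr0 mulrC -prod0 (bigD1_seq b).
Qed.

End LocalRing.

(** * Homomorphisms from a Galois extension to a local ring *)

Section FieldMorphisms.
Variables (k : fieldType) (K : splittingFieldType k).
Hypothesis galK : galois 1 {:K}.

Lemma galois_primitive_element : exists a : K, <<1; a>>%VS = fullv.
Proof.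
have [_ sepK _] := and3P galK.
by exists (separable_generator 1 {:K}); rewrite -eq_adjoin_separable_generator ?sub1v.
Qed.

Section Morphisms.
Variables (B : comNzRingType) (f g : {rmorphism K -> B}).
Hypothesis fg : forall c : k, f c%:A = g c%:A.

Lemma rmorph_eq_on_generator (a : K) : <<1; a>>%VS = fullv -> f a = g a -> f =1 g.
Proof.
move=> genK fa y; have : y \in <<1; a>>%VS by rewrite genK memvf.
case/Fadjoin_polyP => _ /polyOver1P[q ->] ->.
rewrite -!horner_map /= fa; congr _.[_]; apply/polyP => i.
by rewrite !coef_map; exact: fg.
Qed.

(* [g a] is a root of the image of the minimal polynomial of [a], which is the
   product of the [X - f (s a)]. *)
Lemma rmorph_galois_conjugate :
  (forall a b : B, invertible (a + b) -> invertible a \/ invertible b) ->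
  exists s : gal_of {:K}, forall y, g y = f (s y).
Proof.
move=> local_B; have [a genK] := galois_primitive_element.
have /galois_factors/(_ a (memvf a)) := galK.
case/(_ (sub1v _)) => r [_ r_uniq minE].
have /polyOver1P[q qE] := minPolyOver 1 a.
have f_inv (x : K) : x != 0 -> invertible (f x).
  by move=> x0; exists (f x^-1); rewrite -rmorphM mulfV // rmorph1.
have f_inj : injective f.
  move=> x y xy; apply/eqP; rewrite -subr_eq0; apply/negP => /negP/f_inv.
  by rewrite rmorphB xy subrr; apply: not_invertible0.
(* Differences of distinct elements of the field [K] are units, and [f] preserves units, so
   [local_ring_root] applies to the images of the conjugates of [a]. *)
have : g a \in [seq f b | b <- [seq (s : gal_of {:K}) a | s <- r]].
  apply: (local_ring_root local_B); first by rewrite map_inj_uniq.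
    move=> _ _ /mapP[b _ ->] /mapP[c _ ->]; rewrite (inj_eq f_inj) => bc.
    by rewrite -rmorphB; apply: f_inv; rewrite subr_eq0.
  rewrite big_map.
  transitivity (map_poly f (minPoly 1 a)).[g a].
    rewrite minE rmorph_prod horner_prod; apply: eq_bigr => b _.
    by rewrite rmorphB /= map_polyX map_polyC !hornerE.
  transitivity (map_poly g (minPoly 1 a)).[g a].
    congr _.[_]; rewrite qE; apply/polyP => i.
    by rewrite !coef_map; exact: fg.
  by rewrite horner_map /= minPolyxx rmorph0.
case/mapP => _ /mapP[s _ ->] gas; exists s => y.
have : y \in <<1; a>>%VS by rewrite genK memvf.
case/Fadjoin_polyP => _ /polyOver1P[p ->] ->.
rewrite -!horner_map /= gas; congr _.[_]; apply/polyP => i.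
by rewrite !coef_map /= linearZ /= rmorph1; symmetry; exact: fg.
Qed.

End Morphisms.

Lemma rmorph_galois_inj (B : comNzRingType) (f : {rmorphism K -> B}) (s t : gal_of {:K}) :
  (forall y, f (s y) = f (t y)) -> s = t.
Proof.
move=> fst; apply/eqP/gal_eqP => y _; apply/eqP; rewrite -subr_eq0.
apply/negP => /negP d0; apply: (@not_invertible0 B); rewrite -(subrr (f (s y))).
rewrite {2}fst -rmorphB; exists (f (s y - t y)^-1).
by rewrite -rmorphM mulfV // rmorph1.
Qed.

End FieldMorphisms.

(** * Gluing morphisms along a partition into open sets *)

Section Glue.
Local Open Scope classical_set_scope.
Variables (I : Type) (X Y : lrs) (c : X -> I) (f : I -> hom X Y).
Hypothesis c_open : forall i, open (c @^-1` [set i]).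

(** Since [c] is locally constant, near each [x] this family of germs is that of the single morphism
    [f (c x)]. *)
Let glue_germ x := hom_germ (f (c x)) x.

Lemma glue_continuous : continuous (fun x => tag (glue_germ x)).
Proof.
apply/continuousP => V oV.
rewrite (_ : _ @^-1` V = \bigcup_i (c @^-1` [set i] `&` f i @^-1` V)).
  apply: bigcup_open => i _; apply: openI => //.
  by move/continuousP: (@hom_continuous _ _ (f i)); exact.
by apply/seteqP; split=> [x Vx | x [i _ [<-]]] //; exists (c x).
Qed.

Lemma glue_sec V s : open V -> sec V s ->
  sec ((fun x => tag (glue_germ x)) @^-1` V)
      (fun x => tagged (glue_germ x) (s (tag (glue_germ x)))).
Proof.
move=> oV sV.
have oU i : open (f i @^-1` V).
  by move/continuousP: (@hom_continuous _ _ (f i)); exact.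
apply: sec_sheaf; first by move/continuousP: glue_continuous; exact.
move=> x Vx; exists (c @^-1` [set c x] `&` f (c x) @^-1` V).
exists (fun y => tagged (hom_germ (f (c x)) y) (s (tag (hom_germ (f (c x)) y)))).
split=> //; first exact: openI.
  apply: sec_sheaf; first exact: openI.
  move=> y [_ Vy]; exists (f (c x) @^-1` V), (fun y => tagged (hom_germ (f (c x)) y)
    (s (tag (hom_germ (f (c x)) y)))).
  by split=> //; exact: hom_sec.
by move=> y Vy [cy _]; rewrite /glue_germ cy.
Qed.

Definition glue : hom X Y := @Hom X Y glue_germ glue_continuous
  (fun x a => @hom_local _ _ (f (c x)) x a) glue_sec.

End Glue.

Lemma hom_comp_germl (X Y Z : lrs) (g : hom Y Z) (f f' : hom X Y) x :
  hom_germ f x = hom_germ f' x -> hom_germ (g \oS f) x = hom_germ (g \oS f') x.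
Proof. by rewrite /= /stalk_map /hom_fun => ->. Qed.

Lemma hom_comp_germr (X Y Z : lrs) (g g' : hom Y Z) (f : hom X Y) x :
  hom_germ g (f x) = hom_germ g' (f x) -> hom_germ (g \oS f) x = hom_germ (g' \oS f) x.
Proof. by rewrite /= /stalk_map /hom_fun => ->. Qed.

Lemma glue_comp (I : Type) (X Y Z : lrs) (c : X -> I) (f : I -> hom X Y)
    (c_open : forall i, open (c @^-1` [set i])%classic) (g : hom Y Z) (h : hom X Z) :
  (forall x, hom_germ (g \oS f (c x)) x = hom_germ h x) -> g \oS glue f c_open = h.
Proof. by move=> fh; apply: hom_eq => x; rewrite -fh; apply: hom_comp_germl. Qed.

(** * Morphisms to Spec K and their Galois index *)

Section SpecField.
Local Open Scope classical_set_scope.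
Variables (k : fieldType) (K : splittingFieldType k).

Definition coord (X : lrs) (f : hom X (Spec K)) x : {rmorphism K -> stalk x} :=
  stalk_map f x \o to_loc (f x).

(** The only prime ideal of a field is zero, and homomorphisms out of a localization are determined
    on the ring. *)
Lemma coord_eq (X : lrs) (f g : hom X (Spec K)) x :
  coord f x =1 coord g x -> hom_germ f x = hom_germ g x.
Proof.
move=> fg; apply: spec_germ_eq => //; apply: prime_ideal_eq => a.
have mem0 (p : prime_ideal K) : (a \in prime_pred p) = (a == 0).
  have [->|a0] := eqVneq a 0; first exact: prime0.
  apply/negP => pa; have := prime1 p.
  by rewrite -(mulVf a0) primeMl.
by rewrite !mem0.
Qed.

Lemma coordE (X : lrs) (f g : hom X (Spec K)) x :
  hom_germ f x = hom_germ g x -> coord f x =1 coord g x.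
Proof. by move=> fg a; rewrite /coord /stalk_map /hom_fun /= fg. Qed.

Lemma coord_sec (X : lrs) (f : hom X (Spec K)) a : sec setT (fun x => coord f x a).
Proof.
have oT : open [set: Spec K] by exact: openT.
have := @hom_sec _ _ f _ (fun p => to_loc p a) oT; apply.
by move=> p _; exists setT, a, 1; split=> // q _; rewrite prime1 rmorph1 mul1r.
Qed.

Lemma coord_gal (X : lrs) (f : hom X (Spec K)) (s : gal_of {:K}) x a :
  coord (Spec_gal s \oS f) x a = coord f x (s a).
Proof.
rewrite -[LHS]/(stalk_map f x (@loc_map _ _ (s : {rmorphism K -> K}) (f x) (to_loc _ a))).
by rewrite loc_map_to_loc.
Qed.

Lemma coord_ext (X : lrs) (f g : hom X (Spec K)) x c :
  Spec_ext K \oS f = Spec_ext K \oS g -> coord f x c%:A = coord g x c%:A.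
Proof.
move=> fg.
have E (h : hom X (Spec K)) :
    stalk_map (Spec_ext K \oS h) x (to_loc _ c) = coord h x c%:A.
  by rewrite -[LHS]/(stalk_map h x (@loc_map _ _ (in_alg K) (h x) (to_loc _ c))) loc_map_to_loc.
by rewrite -!E fg.
Qed.

Hypothesis galK : galois 1 {:K}.
Variables (X : scheme) (f g : hom X (Spec K)).
Hypothesis fg : Spec_ext K \oS f = Spec_ext K \oS g.

Lemma gal_index_exists x :
  exists s : gal_of {:K}, hom_germ (Spec_gal s \oS f) x = hom_germ g x.
Proof.
have [s sE] := rmorph_galois_conjugate galK (fun c => coord_ext x c fg) (@stalk_local X x).
by exists s; apply: coord_eq => a; rewrite coord_gal sE.
Qed.

(* [Spec K x_k Spec K] is a disjoint union of copies of [Spec K] indexed by the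
   Galois group; [gal_index] is the component containing [(f, g) x]. *)
Definition gal_index x : gal_of {:K} := sval (cid (gal_index_exists x)).

Lemma gal_indexP x : hom_germ (Spec_gal (gal_index x) \oS f) x = hom_germ g x.
Proof. by rewrite /gal_index; case: cid. Qed.

Lemma gal_index_uniq (Y : lrs) (f' : hom Y (Spec K)) y (s t : gal_of {:K}) :
  hom_germ (Spec_gal s \oS f') y = hom_germ (Spec_gal t \oS f') y -> s = t.
Proof.
move=> /coordE st; apply: (@rmorph_galois_inj _ _ _ (coord f' y)) => a.
by rewrite -!coord_gal.
Qed.

(** By a primitive element [a], having index [s] amounts to the vanishing of the germ of one global
    section [d], an open condition. *)
Lemma gal_index_open s : open (gal_index @^-1` [set s]).
Proof.
have [a genK] := galois_primitive_element galK.
rewrite openE => x /= xs.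
have oT : open [set: X] by exact: openT.
pose d y := coord f y (s a) - coord g y a.
have dT : sec setT d by apply: secB => //; exact: coord_sec.
have dx : d x = 0.
  by apply/eqP; rewrite subr_eq0 -coord_gal -xs; apply/eqP/coordE/gal_indexP.
have [V [oV Vx _ d0]] := germ_inj oT dT I dx.
rewrite /interior nbhsE; exists V => // y /d0/eqP; rewrite subr_eq0 -coord_gal => /eqP e.
apply: (@gal_index_uniq _ f y); rewrite gal_indexP; symmetry; apply: coord_eq.
apply: (rmorph_eq_on_generator _ genK e) => c; apply: coord_ext.
by rewrite hom_compA Spec_gal_ext.
Qed.

End SpecField.

(** * Homomorphisms of group schemes and finite sums *)

Section GroupHom.
Variable S : scheme.
Implicit Types G H L : group_scheme S.

Lemma group_hom_comp G H L (f : ohom H L) (g : ohom G H) :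
  group_hom f -> group_hom g -> group_hom (f \oO g).
Proof. by move=> fD gD T x y; rewrite -!ocompA gD fD. Qed.

Lemma group_hom_sum G H (f : ohom G H) : group_hom f ->
  forall T (I : finType) (x : I -> points G T),
  (f \oO \sum_i x i : points H T) = \sum_i (f \oO x i : points H T).
Proof.
move=> fD T I x; apply: (big_morph (fun y : points G T => f \oO y : points H T)) => //.
apply: (addIr (f \oO (0 : points G T) : points H T)).
by rewrite -fD !add0r.
Qed.

Lemma points_sum_comp G T T' (h : ohom T' T) (I : finType) (x : I -> points G T) :
  ((\sum_i x i) \oO h : points G T') = \sum_i (x i \oO h : points G T').
Proof.
apply: (big_morph (fun y : points G T => y \oO h : points G T')).
  by move=> y z; exact: pointsD_comp.
exact: points0_comp.
Qed.

End GroupHom.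

Lemma scalar_ext_group_hom (k : fieldType) (K : splittingFieldType k) (BC : base_changes K)
    (G H : group_scheme (Spec k)) (f : ohom G H) :
  group_hom f -> group_hom (scalar_ext BC f : ohom (gext BC G) (gext BC H)).
Proof.
move=> fD T x y; apply: (can_inj (@of_bcK _ _ _ _ (BC H) T)).
have E (z : points (gext BC G) T) : of_bc (scalar_ext BC f \oO z) = f \oO of_bc z.
  apply: ohom_eq; rewrite -[LHS]/(bc_pr (BC H) \oS (scalar_ext BC f \oS z)).
  by rewrite hom_compA scalar_ext_pr -hom_compA.
by rewrite of_bcD !E of_bcD fD.
Qed.

(** * Splitting the base change of a Weil restriction *)

Section WeilDescent.
Local Open Scope classical_set_scope.
Variables (k : fieldType) (K : splittingFieldType k) (BC : base_changes K).

Definition descend (T : over (Spec K)) : over (Spec k) := over_comp (Spec_ext K) T.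

Section Sections.
Variable T : over (Spec K).

(* The K-morphism [(id, str T)]. *)
Definition diag : ohom T (BC (descend T)) := to_bc (BC (descend T)) (oid (descend T)).

Lemma diag_pr : bc_pr (BC (descend T)) \oS diag = hom_id.
Proof. exact: bc_lift_pr. Qed.

Definition gal_section (s : gal_of {:K}) : hom (BC (descend T)) (BC (descend T)) :=
  twist BC (descend T) s \oS (diag \oS bc_pr (BC (descend T))).

Lemma gal_section_pr s : bc_pr (BC (descend T)) \oS gal_section s = bc_pr (BC (descend T)).
Proof. by rewrite /gal_section hom_compA twist_pr hom_compA diag_pr hom_comp1l. Qed.

Lemma gal_section_str s :
  str (BC (descend T)) \oS gal_section s = Spec_gal s \oS (str T \oS bc_pr (BC (descend T))).
Proof.
rewrite /gal_section hom_compA twist_str -hom_compA; congr (_ \oS _).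
by rewrite hom_compA ohom_str.
Qed.

Lemma descend_ext :
  Spec_ext K \oS (str T \oS bc_pr (BC (descend T))) = Spec_ext K \oS str (BC (descend T)).
Proof. by rewrite -(bcP (BC (descend T))).1 hom_compA. Qed.

Hypothesis galK : galois 1 {:K}.

(** Compares the two maps from T x_k K to Spec K: through [T] and through the second factor. *)
Definition component := gal_index galK descend_ext.

Lemma component_open s : open (component @^-1` [set s]).
Proof. exact: gal_index_open. Qed.

(** Every [gal_section s] preserves the projection to [T], and on the component of index [s] it also
    preserves the map to Spec K. *)
Lemma glue_gal_section : glue gal_section component_open = hom_id.
Proof.
apply: bc_hom_eq; rewrite hom_comp1r; apply: glue_comp => x.
  by rewrite gal_section_pr.
by rewrite gal_section_str gal_indexP.
Qed.

(** Along the [s]-translate of the diagonal, the two maps to Spec K become [str T] and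
    [Spec_gal s \oS str T]. *)
Lemma component_section s t : component (twist BC (descend T) s (diag t)) = s.
Proof.
apply: (@gal_index_uniq _ _ _ (str T) t).
set x := twist _ _ _ _.
have /(@hom_comp_germr _ _ _ _ _ (twist BC (descend T) s \oS diag) t) :
    hom_germ (Spec_gal (component x) \oS (str T \oS bc_pr (BC (descend T)))) x =
    hom_germ (str (BC (descend T))) x by exact: gal_indexP.
rewrite -!hom_compA (hom_compA (bc_pr _)) twist_pr diag_pr hom_comp1r => ->.
by rewrite hom_compA twist_str -hom_compA ohom_str.
Qed.

End Sections.

Section Group.
Variables (A : group_scheme (Spec k)) (W : weil_restriction BC (gext BC A)).
Let AK := gext BC A.
Let WK := gext BC W.

Definition conj_univ (s : gal_of {:K}) : ohom WK AK := galact s (weil_univ W).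

(** The composite bijection Hom_K(T, W_K) = Hom_k(T, W) = Hom_K(T x_k K, A_K). *)
Definition adjoint T (w : points WK T) : points AK (BC (descend T)) := weil_eval (of_bc w).

Lemma adjointD T (w w' : points WK T) : adjoint (w + w') = adjoint w + adjoint w'.
Proof. by rewrite /adjoint of_bcD weil_evalD. Qed.

(** Conjugation fixes the base change of [of_bc w], which restricts to [w] along the diagonal. *)
Lemma adjoint_diag s T (w : points WK T) :
  galact s (adjoint w) \oO diag T = conj_univ s \oO w.
Proof.
rewrite galact_comp galact_scalar_ext -ocompA; congr (_ \oO _).
apply: bc_ohom_eq.
rewrite -[LHS]/(bc_pr (BC W) \oS (scalar_ext BC (of_bc w) \oS diag T)).
rewrite hom_compA scalar_ext_pr -hom_compA diag_pr.
exact: hom_comp1r.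
Qed.

Lemma conj_univ_group_hom s : group_hom (conj_univ s).
Proof.
by move=> T x y; rewrite -!adjoint_diag adjointD galactD; exact: (@pointsD_comp _ AK).
Qed.

Lemma galact_diag s T (x : ohom (BC (descend T)) AK) :
  x \oS (twist BC (descend T) s \oS diag T) =
  twist BC A s \oS (galact s^-1%g x \oO diag T).
Proof. by rewrite /= invgK !hom_compA twistVK hom_comp1l. Qed.

Hypothesis galK : galois 1 {:K}.

(** A morphism is glued from its restrictions to the translates of the diagonal, and [galact_diag]
    reads these off from its conjugates. *)
Lemma galact_diag_inj T (x y : ohom (BC (descend T)) AK) :
  (forall s, galact s x \oO diag T = galact s y \oO diag T) -> x = y.
Proof.
move=> xy; have xyE s : x \oS gal_section T s = y \oS gal_section T s.
  by rewrite /gal_section !(hom_compA _ _ (bc_pr _)) !galact_diag xy.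
apply: ohom_eq; rewrite -[LHS]hom_comp1r -(glue_gal_section T galK).
apply: glue_comp => z; rewrite xyE -[in RHS](hom_comp1r y) -(glue_gal_section T galK).
exact: hom_comp_germl.
Qed.

Lemma conj_univ_inj T (w w' : points WK T) :
  (forall s, conj_univ s \oO w = conj_univ s \oO w') -> w = w'.
Proof.
move=> ww; apply: (can_inj (@of_bcK _ _ _ _ (BC W) T)).
apply: (@weil_eval_inj _ _ _ _ W); apply: galact_diag_inj => s.
by rewrite !adjoint_diag.
Qed.

Lemma conj_univ_exists T (x : gal_of {:K} -> points AK T) :
  exists w : points WK T, forall s, conj_univ s \oO w = x s.
Proof.
pose Z := BC (descend T).
(* By [galact_diag], this is the only possible value on the component of index [s]; hence the
   inverse. *)
pose p s : hom Z AK := twist BC A s \oS (x s^-1%g \oS bc_pr Z).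
(* The twist in [p s] is compensated on the component of index [s], so the glued map is a
   K-morphism. *)
have p_str : str AK \oS glue p (component_open T galK) = str Z.
  apply: glue_comp => z; rewrite hom_compA twist_str -hom_compA (hom_compA _ (x _)).
  by rewrite ohom_str gal_indexP.
pose P : points AK Z := @OHom _ Z AK _ p_str.
have [g _ gK] := weil_bij W (descend T).
exists (to_bc (BC W) (g P)) => s; rewrite -adjoint_diag /adjoint to_bcK.
rewrite [weil_eval _]gK; apply: ohom_eq => /=.
rewrite -!hom_compA.
(* The image of this translate lies in the component of index [s^-1], where the glued map is
   [p s^-1]. *)
have -> : glue p (component_open T galK) \oS (twist BC (descend T) s^-1%g \oS diag T) =
          twist BC A s^-1%g \oS x s.
  apply: hom_eq => t.
  transitivity (hom_germ (p s^-1%g \oS (twist BC (descend T) s^-1%g \oS diag T)) t).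
    apply: hom_comp_germr; set z := (_ \oS _) t.
    rewrite -[LHS]/(hom_germ (p (component galK z)) z).
    by rewrite (component_section galK s^-1%g t : component galK z = _).
  rewrite /p invgK -!hom_compA (hom_compA (bc_pr _)) twist_pr diag_pr.
  by rewrite hom_comp1r.
by rewrite hom_compA twistVK hom_comp1l.
Qed.


(** The conjugates of [u] are the projections of a product, so the injections [i t] are given by
    their coordinates and identities are tested after each projection. *)
Lemma split_univ : exists i : gal_of {:K} -> ohom AK WK,
  [/\ forall s, group_hom (i s),
      forall s t, conj_univ s \oO i t = endo_hom ((s == t)%:R : endo AK)
    & \sum_s (i s \oO conj_univ s : points WK WK) = oid WK].
Proof.
pose i t : ohom AK WK := sval (cid (conj_univ_exists (fun s => endo_hom ((s == t)%:R : endo AK)))).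
have iE s t : conj_univ s \oO i t = endo_hom ((s == t)%:R : endo AK) by rewrite /i; case: cid.
exists i; split=> // [t T x y|].
  apply: conj_univ_inj => s; rewrite (conj_univ_group_hom s) !ocompA iE.
  exact: endoP.
apply: conj_univ_inj => s; rewrite (group_hom_sum (conj_univ_group_hom s)).
rewrite (bigD1 s) //= big1 => [|t /negbTE ts]; last first.
  rewrite ocompA iE eq_sym ts; exact: (@points0_comp _ AK).
rewrite addr0 ocompA iE eqxx; apply: ohom_eq.
by rewrite /= hom_comp1l hom_comp1r.
Qed.

End Group.
End WeilDescent.

(** * The map from the skew group ring *)

Section SkewMorphism.
Variables (k : fieldType) (K : splittingFieldType k) (BC : base_changes K).
Variables (A : group_scheme (Spec k)) (W : weil_restriction BC (gext BC A)).
Let AK := gext BC A.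
Let WK := gext BC W.

Lemma weil_eval_endo_inj (e e' : endo W) :
  weil_eval (endo_point e) = weil_eval (endo_point e') -> e = e'.
Proof. by move/weil_eval_inj => h; apply: endo_eq. Qed.

Lemma weil_eval_res (l : endo AK) Z (x : points W Z) :
  weil_eval (endo_hom (weil_res W l) \oO x : points W Z) = endo_hom l \oO weil_eval x.
Proof. by rewrite /weil_eval scalar_ext_comp ocompA weil_resP ocompA. Qed.

(** Evaluate [weil_galP] at the identity point of [W], which corresponds to [u]. *)
Lemma weil_eval_gal s : weil_eval (endo_point (weil_gal W s)) = conj_univ W s.
Proof.
have := weil_galP s (oid W : points W W); rewrite weil_id /conj_univ => <-.
by congr weil_eval; apply: ohom_eq; rewrite /= hom_comp1r.
Qed.

Lemma weil_resD : {morph weil_res W : l m / l + m}.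
Proof.
move=> l m; apply: weil_eval_endo_inj.
rewrite -[endo_point (_ + _)]/(endo_point (weil_res W l) + endo_point (weil_res W m)).
rewrite weil_evalD /weil_eval !weil_resP.
exact: (@pointsD_comp _ AK).
Qed.

Lemma weil_res0 : weil_res W 0 = 0.
Proof. by apply: (addIr (weil_res W 0)); rewrite -weil_resD !add0r. Qed.

Lemma weil_resM : {morph weil_res W : l m / l * m}.
Proof.
move=> l m; apply: weil_eval_endo_inj.
rewrite -[endo_point (_ * _)]/(endo_hom (weil_res W l) \oO endo_point (weil_res W m)).
rewrite weil_eval_res /weil_eval !weil_resP ocompA.
by [].
Qed.

Lemma weil_res1 : weil_res W 1 = 1.
Proof.
apply: weil_eval_endo_inj; rewrite [RHS]weil_id /weil_eval weil_resP.
by apply: ohom_eq; rewrite /= hom_comp1l.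
Qed.

Lemma weil_gal1 : weil_gal W 1%g = 1.
Proof. by apply: weil_eval_endo_inj; rewrite weil_eval_gal [RHS]weil_id; exact: galact1. Qed.

Lemma weil_galM s t : weil_gal W (s * t)%g = weil_gal W s * weil_gal W t.
Proof.
apply: weil_eval_endo_inj; rewrite weil_eval_gal.
rewrite -[endo_point _]/(endo_hom (weil_gal W s) \oO endo_point (weil_gal W t)).
by rewrite weil_galP weil_eval_gal; exact: galactM.
Qed.

(** The defining relation of the skew group ring; it comes from s(l u) = s(l) s(u). *)
Lemma weil_gal_res s l :
  weil_gal W s * weil_res W l = weil_res W (gal_action BC A s l) * weil_gal W s.
Proof.
apply: weil_eval_endo_inj.
rewrite -[X in weil_eval X = _]/(endo_hom (weil_gal W s) \oO endo_point (weil_res W l)).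
rewrite -[X in _ = weil_eval X]
  /(endo_hom (weil_res W (gal_action BC A s l)) \oO endo_point (weil_gal W s)).
by rewrite weil_galP weil_eval_res weil_eval_gal /weil_eval weil_resP galact_comp.
Qed.

Definition weil_skew (x : skew_ring (gal_action BC A)) : endo W :=
  \sum_(s : gal_of {:K}) weil_res W (x s) * weil_gal W s.

Lemma weil_skewB : zmod_morphism weil_skew.
Proof.
move=> x y; apply/eqP; rewrite eq_sym subr_eq; apply/eqP.
rewrite /weil_skew -big_split /=; apply: eq_bigr => s _.
by rewrite -mulrDl -weil_resD !ffunE subrK.
Qed.

Lemma weil_skewM : monoid_morphism weil_skew.
Proof.
split=> [|x y].
  rewrite /weil_skew (bigD1 1%g) //= big1 => [|s /negbTE s1]; rewrite ffunE.
    by rewrite eqxx weil_res1 weil_gal1 mulr1 addr0.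
  by rewrite s1 weil_res0 mul0r.
rewrite /weil_skew.
(* Each [r] is factored as [s] times [s^-1 * r]; for fixed [s], the sum over [r] then runs over the
   whole second factor. *)
transitivity (\sum_(r : gal_of {:K}) \sum_(s : gal_of {:K})
    weil_res W (x s) * weil_gal W s *
    (weil_res W (y (s^-1 * r)%g) * weil_gal W (s^-1 * r)%g)).
  apply: eq_bigr => r _; rewrite -[x * y]/(skew_mul x y) skew_mulE.
  rewrite (big_morph _ weil_resD weil_res0) mulr_suml; apply: eq_bigr => s _.
  by rewrite weil_resM -!mulrA (mulrA (weil_gal W s)) weil_gal_res -mulrA -weil_galM mulKVg.
rewrite exchange_big mulr_suml; apply: eq_bigr => s _.
rewrite mulr_sumr [RHS](reindex (fun r => s^-1 * r)%g) //=.
by exists (fun r => s * r)%g => r _; rewrite ?mulKg ?mulKVg.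
Qed.

(** The coefficients of [x] become coordinates with respect to the projections [conj_univ W s], so
    [split_univ] can recover them. *)
Lemma weil_eval_skew x : weil_eval (endo_point (weil_skew x)) =
  \sum_s (endo_hom (x s) \oO conj_univ W s : points AK (BC W)).
Proof.
have evD : {morph (fun e : endo W => weil_eval (endo_point e)) : e e' / e + e'}.
  by move=> e e'; exact: weil_evalD.
have ev0 : weil_eval (endo_point (0 : endo W)) = 0.
  by apply: (addIr (weil_eval (endo_point (0 : endo W)))); rewrite -evD !add0r.
rewrite /weil_skew (big_morph _ evD ev0); apply: eq_bigr => s _.
by rewrite [LHS]weil_eval_res weil_eval_gal.
Qed.

Hypothesis galK : galois 1 {:K}.

Lemma weil_skew_bij : bijective weil_skew.
Proof.
have [i [i_hom univ_i i_sum]] := split_univ W galK.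
have eval_hom (e : endo W) : group_hom (weil_eval (endo_point e) : ohom WK AK).
  (* [u] is its own conjugate by the identity. *)
  have u_hom : group_hom (weil_univ W : ohom WK AK).
    by have := @conj_univ_group_hom _ _ _ _ W 1%g; rewrite /conj_univ galact1.
  exact: group_hom_comp u_hom (scalar_ext_group_hom (endoP e)).
exists (fun e => [ffun s => Endo (group_hom_comp (eval_hom e) (i_hom s))]
  : skew_ring (gal_action BC A)) => [x | e].
  apply/ffunP => t; rewrite ffunE; apply: endo_eq => /=.
  rewrite weil_eval_skew (@points_sum_comp _ AK).
  have termE s : (endo_hom (x s) \oO conj_univ W s) \oO i t =
      endo_hom (x s * (s == t)%:R) by rewrite -ocompA univ_i.
  rewrite (bigD1 t) //= big1 => [|s /negbTE st]; rewrite termE.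
    by rewrite eqxx mulr1 addr0.
  by rewrite st mulr0.
apply: weil_eval_endo_inj; rewrite weil_eval_skew.
(* Insert the decomposition of the identity of W_K. *)
transitivity ((weil_eval (endo_point e) : ohom WK AK) \oO
    (\sum_s (i s \oO conj_univ W s : points WK WK))).
  rewrite (group_hom_sum (eval_hom e)); apply: eq_bigr => s _.
  by rewrite ffunE ocompA.
by rewrite i_sum; apply: ohom_eq; rewrite /= hom_comp1r.
Qed.

End SkewMorphism.

Theorem theorem3 (k : fieldType) (K : splittingFieldType k)
    (galK : galois 1 {:K})
    (BC : base_changes K)
    (A : abelian_variety k)
    (W : weil_restriction BC (gext BC A)) :
  let Phi : skew_ring (gal_action BC A) -> endo W :=
    fun x => \sum_(s : gal_of {:K}) weil_res W (x s) * weil_gal W s in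
  [/\ zmod_morphism Phi, monoid_morphism Phi & bijective Phi].
Proof.
by split; [exact: weil_skewB | exact: weil_skewM | exact: weil_skew_bij].
Qed.
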